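(* Set automata and $\mathrm{EMSO}^2[\Sigma,<,+1,\sim,\oplus 1,\mathcal{F}]$ are expressively equivalent: a data language is recognised by some set automaton if and only if it is the set of data words satisfying some formula of $\mathrm{EMSO}^2[\Sigma,<,+1,\sim,\oplus 1,\mathcal{F}]$.
   Context: Fix an infinite set $\mathcal{D}$ of data values. A data word $(a_1,d_1)\cdots(a_n,d_n)$ over $\Sigma$ is a structure on positions $\{1,\dots,n\}$ with $a(x)$ ($a\in\Sigma$), $<$, $y=x+1$, $x\sim y$ iff same data value, and class successor $y=x\oplus 1$ iff $x<y$, $x\sim y$ and no position strictly between has the same data value. For a regular language $L$ over $\Gamma$, the regular predicate $L(x,y)$ holds at $(i,j)$ iff $i<j$ and the word of $\Gamma$-labels strictly between $i$ and $j$ is in $L$. $\mathrm{EMSO}^2[\Sigma,<,+1,\sim,\oplus 1,\mathcal{F}]$ consists of formulas $\exists X_1\cdots\exists X_n\,\varphi$ with monadic set variables $X_i$ and $\varphi$ a first-order formula in two variables $x,y$ over atoms $a(x)$, $X_i(x)$, $x=y$, $x<y$, $y=x+1$, $x\sim y$, $y=x\oplus 1$, and regular predicates $L(x,y)$ with $L$ regular over $\Gamma=\Sigma\times 2^{\{X_1,\dots,X_n\}}$. Set automata: for finite $Y$, $\mathbbm{2}^Y$ is $\{0,1\}$-vectors indexed by $Y$, $\mathbf{R}_Y$ the binary relations on $Y$. A set automaton $(Q,Y,\Sigma,\Delta,I,F,C)$ has finite states $Q$, set names $Y$, $\Delta\subseteq Q\times\Sigma\times\mathbbm{2}^Y\times\mathbf{R}_Y\times\mathbbm{2}^Y\times\mathbbm{2}^Y\times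 Q$, $I,F\subseteq Q$, $C\subseteq\mathbbm{2}^Y$. Configurations $(q,(X_y)_{y\in Y})$, $X_y\subseteq\mathcal{D}$; initial if $q\in I$, all empty. On $(a,d)$, transition $(p,\ell,\bar z,\rho,\bar u,\bar v,p')$ applies iff $p=q$, $\ell=a$, $\bar z$ is the characteristic vector of $d$; it yields $(p',\bar X'')$ with $X'_y=\bigcup_{(x,y)\in\rho}X_x$, $X''_y=(X'_y\cup U_y)\setminus V_y$, $U_y=\{d\}$ iff $u_y=1$, $V_y=\{d\}$ iff $v_y=1$ (else $\emptyset$). Accepting: $q\in F$ and every data value present in some $X_y$ has characteristic vector in $C$; the language is the set of data words with a run from an initial to an accepting configuration. *)

(* Defs.v *)
From mathcomp Require Import all_boot.
From mathcomp Require Import boolp classical_sets cardinality.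

Set Implicit Arguments.
Unset Strict Implicit.
Unset Printing Implicit Defensive.

Local Open Scope classical_set_scope.

Definition data_word (Sigma : finType) (D : Type) := seq (Sigma * D).

Definition data_language (Sigma : finType) (D : Type) :=
  set (data_word Sigma D).

Definition ext_letter (Sigma : finType) (n : nat) : finType :=
  (Sigma * {set 'I_n})%type.

(* The factor of [s] strictly between positions [i] and [j]. *)
Definition between T (s : seq T) (i j : nat) : seq T := drop i.+1 (take j s).

(* Positions are numbered from 0: the domain of the structure of [w] is
   {i : nat | i < size w}, and [has_letter], [has_datum], [same_data],
   [succ_pos] and [class_succ] are false at numbers that are not positions. *)
Section Structure.
Variables (Sigma : finType) (D : Type).
Implicit Types (w : data_word Sigma D) (i j k : nat).

Definition has_letter w (a : Sigma) i : Prop :=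
  exists d, onth w i = Some (a, d).

Definition has_datum w (d : D) i : Prop :=
  exists a, onth w i = Some (a, d).

Definition same_data w i j : Prop :=
  exists2 d, has_datum w d i & has_datum w d j.

Definition succ_pos w i j : Prop := j < size w /\ j = i.+1.

Definition class_succ w i j : Prop :=
  [/\ i < j, same_data w i j & forall k, i < k < j -> ~ same_data w i k].

(* The word over [ext_letter Sigma n] obtained from [w] by dropping the data
   values and recording, at each position, which sets [X k] it belongs to. *)
Definition ext_word n (X : 'I_n -> set nat) w : seq (ext_letter Sigma n) :=
  [seq (p.1.1, [set k | p.2 \in X k]%SET) | p <- zip w (iota 0 (size w))].

End Structure.

Record dfa (Gamma : finType) := DFA {
  dfa_state : finType;
  dfa_init : dfa_state;
  dfa_trans : dfa_state -> Gamma -> dfa_state;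
  dfa_final : {set dfa_state} }.

Definition dfa_accepts (Gamma : finType) (A : dfa Gamma) (s : seq Gamma) : bool :=
  foldl (@dfa_trans _ A) (dfa_init A) s \in dfa_final A.

Definition regular (Gamma : finType) (L : set (seq Gamma)) : Prop :=
  exists A : dfa Gamma, forall s, L s <-> dfa_accepts A s.

Inductive var := vx | vy.

Definition eqv (u v : var) : bool :=
  match u, v with vx, vx | vy, vy => true | _, _ => false end.

Inductive fo2 (Sigma : finType) (n : nat) : Type :=
| FLetter of Sigma & var
| FSet of 'I_n & var
| FEq of var & var
| FLt of var & var
| FSucc of var & var       (* FSucc u v is  v = u + 1 *)
| FSim of var & var
| FClassSucc of var & var  (* FClassSucc u v is  v = u (+) 1 *)
| FReg (L : set (seq (ext_letter Sigma n))) of regular L & var & var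
| FNot of fo2 Sigma n
| FAnd of fo2 Sigma n & fo2 Sigma n
| FOr of fo2 Sigma n & fo2 Sigma n
| FEx of var & fo2 Sigma n
| FAll of var & fo2 Sigma n.

Fixpoint free (Sigma : finType) (n : nat) (phi : fo2 Sigma n) (t : var) : bool :=
  match phi with
  | FLetter _ u | FSet _ u => eqv t u
  | FEq u v | FLt u v | FSucc u v | FSim u v | FClassSucc u v
  | FReg _ _ u v => eqv t u || eqv t v
  | FNot f => free f t
  | FAnd f g | FOr f g => free f t || free g t
  | FEx u f | FAll u f => ~~ eqv t u && free f t
  end.

Definition update (e : var -> nat) (u : var) (i : nat) : var -> nat :=
  fun t => if eqv t u then i else e t.

Fixpoint sat (Sigma : finType) (D : Type) (n : nat) (w : data_word Sigma D)
    (X : 'I_n -> set nat) (e : var -> nat) (phi : fo2 Sigma n) : Prop :=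
  match phi with
  | FLetter a u => has_letter w a (e u)
  | FSet k u => X k (e u)
  | FEq u v => e u = e v
  | FLt u v => e u < e v
  | FSucc u v => succ_pos w (e u) (e v)
  | FSim u v => same_data w (e u) (e v)
  | FClassSucc u v => class_succ w (e u) (e v)
  | FReg L _ u v => e u < e v /\ L (between (ext_word X w) (e u) (e v))
  | FNot f => ~ sat w X e f
  | FAnd f g => sat w X e f /\ sat w X e g
  | FOr f g => sat w X e f \/ sat w X e g
  | FEx u f => exists2 i, i < size w & sat w X (update e u i) f
  | FAll u f => forall i, i < size w -> sat w X (update e u i) f
  end.

(* [exists X_0 ... X_(n-1), matrix], where [matrix] is closed as regards its
   first-order variables. *)
Record emso2 (Sigma : finType) := EMSO2 {
  nb_sets : nat;
  matrix : fo2 Sigma nb_sets;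
  matrix_closed : forall t, ~~ free matrix t }.

(* The initial valuation is irrelevant because the matrix is closed; using
   numbers instead of positions makes sense of the empty data word too. *)
Definition emso2_language (Sigma : finType) (D : Type) (phi : emso2 Sigma) :
    data_language Sigma D :=
  [set w | exists X : 'I_(nb_sets phi) -> set nat,
     (forall k, X k `<=` [set i | i < size w]) /\
     sat w X (fun=> 0) (matrix phi)].

Definition bvec (Y : finType) : finType := {ffun Y -> bool}.

Definition brel (Y : finType) : finType := {set Y * Y}.

Record set_automaton (Sigma : finType) := SetAutomaton {
  sa_state : finType;
  sa_name : finType;
  sa_delta : {set sa_state * Sigma * bvec sa_name * brel sa_name *
                  bvec sa_name * bvec sa_name * sa_state};
  sa_init : {set sa_state};
  sa_final : {set sa_state};
  sa_acc : {set bvec sa_name} }.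

Section SetAutomaton.
Variables (Sigma : finType) (D : Type) (A : set_automaton Sigma).
Local Notation Q := (sa_state A).
Local Notation Y := (sa_name A).

Definition config : Type := Q * (Y -> set D).

Definition char_vec (X : Y -> set D) (d : D) : bvec Y :=
  [ffun y => d \in X y].

Definition data_if (b : bool) (d : D) : set D := if b then [set d] else set0.

Definition set_update (rho : brel Y) (u v : bvec Y) (d : D) (X : Y -> set D) :
    Y -> set D :=
  fun y => (\bigcup_(x in [set x | (x, y) \in rho]) X x `|` data_if (u y) d)
             `\` data_if (v y) d.

Definition sa_step (c : config) (s : Sigma * D) (c' : config) : Prop :=
  exists (rho : brel Y) (u v : bvec Y),
    (c.1, s.1, char_vec c.2 s.2, rho, u, v, c'.1) \in sa_delta A /\
    c'.2 = set_update rho u v s.2 c.2.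

Fixpoint sa_run (c : config) (w : data_word Sigma D) (c' : config) : Prop :=
  if w is s :: w' then exists2 c1, sa_step c s c1 & sa_run c1 w' c'
  else c = c'.

Definition initial (c : config) : Prop :=
  c.1 \in sa_init A /\ forall y, c.2 y = set0.

Definition accepting (c : config) : Prop :=
  c.1 \in sa_final A /\
  forall d, (exists y, c.2 y d) -> char_vec c.2 d \in sa_acc A.

Definition sa_language : data_language Sigma D :=
  [set w | exists c c', [/\ initial c, sa_run c w c' & accepting c']].

End SetAutomaton.

(* Main.v *)
Require Import Defs.
From mathcomp Require Import all_boot.
From mathcomp Require Import boolp classical_sets cardinality.

(* Both formalisms describe the same class languages: guess a relabelling of the
   data word and require, for every datum d, that the class word of d, in which
   the positions carrying d are marked, belong to a fixed regular language.

   A set automaton recognises a class language: when the guessed labels are its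
   transitions, the characteristic vector of d, hence the success of all tests
   of d, is computed along the class word of d.  Conversely, a set automaton can
   store, for each datum already seen, the state of a finite automaton reading
   its class word, while its control state serves all the unseen data.

   From a formula, guess at every position the truth value of each quantified
   subformula.  The guesses at the positions carrying d can be checked on the
   class word of d, since x ~ y then means that y is marked too.

   From a class language, guess at every position the state in which a finite
   automaton reading the class word of its datum arrives there.  A regular
   predicate propagates this state to the class successor, where it is compared
   with the guess. *)

Set Implicit Arguments.
Unset Strict Implicit.
Unset Printing Implicit Defensive.

Local Open Scope classical_set_scope.

Section Relabelling.
Variable T : Type.

Definition relabel B B' (f : B -> B') (v : seq (B * T)) : seq (B' * T) :=
  [seq (f x.1, x.2) | x <- v].

Lemma relabel_id B (v : seq (B * T)) : relabel id v = v.
Proof. by rewrite /relabel -[RHS]map_id; apply: eq_map => -[]. Qed.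

Lemma relabel_comp B1 B2 B3 (g : B2 -> B3) (f : B1 -> B2) v :
  relabel g (relabel f v) = relabel (g \o f) v.
Proof. by rewrite /relabel -map_comp. Qed.

Lemma map_fst_relabel B B' (f : B -> B') v :
  map fst (relabel f v) = map f (map fst v).
Proof. by rewrite /relabel -!map_comp. Qed.

Lemma relabel_surj B B' (f : B -> B') (u : seq (B' * T)) :
  (forall i b', onth (map fst u) i = Some b' -> exists b, f b = b') ->
  exists v, relabel f v = u.
Proof.
elim: u => [|[b' x] u IH] fu; first by exists [::].
have [b <-] := fu 0 b' erefl.
have [|v <-] := IH; first by move=> i; apply: (fu i.+1).
by exists ((b, x) :: v).
Qed.

Lemma onth_relabel B B' (f : B -> B') v i :
  onth (relabel f v) i = omap (fun x => (f x.1, x.2)) (onth v i).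
Proof. exact: onth_map. Qed.

End Relabelling.

(** * Regular languages *)

Section RegularLanguages.
Implicit Types Gamma : finType.

Lemma eq_regular Gamma (K L : set (seq Gamma)) :
  (forall s, K s <-> L s) -> regular K -> regular L.
Proof. by move=> KL [A AK]; exists A => s; rewrite -KL. Qed.

Lemma regular_foldl Gamma (Q : finType) (step : Q -> Gamma -> Q) q
    (p : pred Q) :
  regular (fun s => p (foldl step q s)).
Proof.
by exists (DFA q step [set r | p r]%SET) => s; rewrite /dfa_accepts /= inE.
Qed.

Lemma regularP Gamma (L : set (seq Gamma)) : regular L ->
  exists (Q : finType) (step : Q -> Gamma -> Q) (q : Q) (p : pred Q),
    forall s, L s <-> p (foldl step q s).
Proof.
by case=> A AL; exists (dfa_state A), (@dfa_trans _ A), (dfa_init A),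
  (mem (dfa_final A)).
Qed.

Lemma regular_all Gamma (p : pred Gamma) : regular (fun s => all p s).
Proof.
apply: eq_regular (regular_foldl (fun b a => b && p a) true id) => s.
suff -> b : foldl (fun b a => b && p a) b s = b && all p s by [].
by elim: s b => [|a s IH] b /=; rewrite ?andbT ?IH ?andbA.
Qed.

Lemma regular_cst Gamma (P : Prop) : regular (fun _ : seq Gamma => P).
Proof.
apply: eq_regular (regular_foldl (fun b _ => b) `[<P>] id) => s.
suff -> : foldl (fun (b : bool) _ => b) `[<P>] s = `[<P>] by rewrite asboolE.
by elim: s.
Qed.

Lemma regularC Gamma (L : set (seq Gamma)) : regular L -> regular (~` L).
Proof.
move/regularP=> [Q [step [q [p Lp]]]].
apply: eq_regular (regular_foldl step q (predC p)) => s /=.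
by rewrite Lp; split=> /negP.
Qed.

Lemma regularI Gamma (K L : set (seq Gamma)) :
  regular K -> regular L -> regular (K `&` L).
Proof.
move=> /regularP[Q [step [q [p Kp]]]] /regularP[Q' [step' [q' [p' Lp']]]].
pose prod_step (r : Q * Q') a := (step r.1 a, step' r.2 a).
apply: eq_regular
  (regular_foldl prod_step (q, q') (fun r => p r.1 && p' r.2)) => s.
have -> r : foldl prod_step r s = (foldl step r.1 s, foldl step' r.2 s).
  by elim: s r => [|a s IH] [r r'] //=; rewrite IH.
by rewrite /setI /= Kp Lp'; split=> /andP.
Qed.

Lemma regular_imply Gamma (K L : set (seq Gamma)) :
  regular K -> regular L -> regular (fun s => K s -> L s).
Proof.
move=> rK rL; apply: eq_regular (regularC (regularI rK (regularC rL))) => s.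
by rewrite /setC /setI /= not_andP notK implyE.
Qed.

Lemma regular_nil Gamma : regular (fun s : seq Gamma => s = [::]).
Proof. by apply: eq_regular (regular_all pred0) => -[]. Qed.

Lemma regular_map Gamma Gamma' (f : Gamma' -> Gamma) (L : set (seq Gamma)) :
  regular L -> regular (fun s => L (map f s)).
Proof.
move/regularP=> [Q [step [q [p Lp]]]].
pose step' r a := step r (f a).
apply: eq_regular (regular_foldl step' q p) => s; rewrite Lp.
suff -> r : foldl step' r s = foldl step r (map f s) by [].
by elim: s r => //= a s IH r; rewrite IH.
Qed.

Lemma regular_image Gamma Gamma' (f : Gamma -> Gamma') (L : set (seq Gamma)) :
  injective f -> regular L -> regular (map f @` L).
Proof.
move=> f_inj /regularP[Q [step [q [p Lp]]]].
pose decode_step (o : option Q) a' :=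
  if o is Some r then omap (step r) [pick a | f a == a'] else None.
apply: eq_regular (regular_foldl decode_step (Some q) (oapp p false)) => s'.
have runE s r : foldl decode_step (Some r) (map f s) = Some (foldl step r s).
  elim: s r => //= a s IH r; rewrite -IH; case: pickP => /= [b /eqP/f_inj->//|].
  by move/(_ a); rewrite eqxx.
have run_image r : foldl decode_step (Some r) s' -> exists s, map f s = s'.
  elim: s' r => [|a' s' IH] r /=; first by exists [::].
  case: pickP => [a /eqP <- /IH[s <-]|_] /=; first by exists (a :: s).
  by rewrite (_ : foldl _ _ _ = None) //; elim: s' {IH}.
split=> [acc|[s Ls <-]]; last by rewrite runE /=; apply/Lp.
have [s sE] : exists s, map f s = s'.
  by apply: (run_image q); case: foldl acc.
by exists s => //; apply/Lp; move: acc; rewrite -sE runE.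
Qed.

Lemma regular_cons Gamma (L : set (seq Gamma)) a :
  regular L -> regular (fun s => L (a :: s)).
Proof.
move/regularP=> [Q [step [q [p Lp]]]].
by apply: eq_regular (regular_foldl step (step q a) p) => s; rewrite Lp.
Qed.

Lemma regular_rcons Gamma (L : set (seq Gamma)) a :
  regular L -> regular (fun s => L (rcons s a)).
Proof.
move/regularP=> [Q [step [q [p Lp]]]].
apply: eq_regular (regular_foldl step q (fun r => p (step r a))) => s.
by rewrite Lp foldl_rcons.
Qed.

End RegularLanguages.

(** * Regular relations between positions *)

Section Marks.
Variable T : Type.
Implicit Types (s : seq T) (P : pred nat) (i : nat).

Fixpoint mark s P : seq (T * bool) :=
  if s is a :: s' then (a, P 0) :: mark s' (fun i => P i.+1) else [::].

Lemma size_mark s P : size (mark s P) = size s.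
Proof. by elim: s P => //= a s IH P; rewrite IH. Qed.

Lemma map_fst_mark s P : map fst (mark s P) = s.
Proof. by elim: s P => //= a s IH P; rewrite IH. Qed.

Lemma mark_pred0 s : mark s xpred0 = [seq (a, false) | a <- s].
Proof. by elim: s => //= a s ->. Qed.

Lemma all_mark s i (p : pred T) : i < size s ->
  all (fun x => x.2 ==> p x.1) (mark s (pred1 i)) = oapp p false (onth s i).
Proof.
elim: s i => [|a s IH] [|i] //=; last by rewrite ltnS => /IH.
by rewrite mark_pred0 all_map (eq_all (a2 := predT)) // all_predT andbT.
Qed.

End Marks.

Lemma map_mark T T' (f : T -> T') s P :
  mark (map f s) P = relabel f (mark s P).
Proof. by elim: s P => //= a s IH P; rewrite IH. Qed.

Lemma mark_swap T (s : seq T) P P' :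
  mark (mark s P) P' = [seq (x.1.1, x.2, x.1.2) | x <- mark (mark s P') P].
Proof. by elim: s P P' => //= a s IH P P'; rewrite IH. Qed.

Lemma mark_diag T (s : seq T) P :
  mark (mark s P) P = [seq (x, x.2) | x <- mark s P].
Proof. by elim: s P => //= a s IH P; rewrite IH. Qed.

Lemma regular_ex_mark (Gamma : finType) (L : set (seq (Gamma * bool))) :
  regular L -> regular (fun s => exists2 i, i < size s & L (mark s (pred1 i))).
Proof.
move/regularP=> [Q [step [q [p Lp]]]].
(* The second component collects the states of the runs in which the mark has
   already been placed. *)
pose subset_step (r : Q * {set Q}) a :=
  (step r.1 (a, false),
   step r.1 (a, true) |: [set step t (a, false) | t in r.2])%SET.
have subset_stepP s r S t : t \in (foldl subset_step (r, S) s).2 <->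
    (exists2 t0, t0 \in S & foldl step t0 (mark s xpred0) = t) \/
    (exists2 i, i < size s & foldl step r (mark s (pred1 i)) = t).
  elim: s r S => [|a s IH] r S /=.
    by split=> [tS|[[t0 t0S <-]|[]]] //; left; exists t.
  rewrite IH; split=> [[[t1]|[i si <-]]|[[t0 t0S <-]|[[|i] si <-]]].
  - rewrite !inE => /predU1P[->|/imsetP[t0 t0S ->]] <-.
      by right; exists 0.
    by left; exists t0.
  - by right; exists i.+1.
  - by left; exists (step t0 (a, false)) => //; rewrite setU1r // imset_f.
  - by left; exists (step r (a, true)) => //; rewrite setU11.
  - by right; exists i.
apply: eq_regular (regular_foldl subset_step (q, finset.set0)
  (fun r => [exists t, (t \in r.2) && p t])) => s; split.
- case/existsP=> t /andP[/subset_stepP[[t0 t0P _]|[i si <-]] pt].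
    by rewrite inE in t0P.
  by exists i => //; apply/Lp.
- case=> i si /Lp accepted; apply/existsP.
  exists (foldl step q (mark s (pred1 i))).
  by rewrite accepted andbT; apply/subset_stepP; right; exists i.
Qed.

Definition regular_rel (Gamma : finType)
    (R : seq Gamma -> nat -> nat -> Prop) : Prop :=
  exists2 L, regular L & forall s i j, i < size s -> j < size s ->
    (R s i j <-> L (mark (mark s (pred1 i)) (pred1 j))).

Section RegularRelations.
Variable Gamma : finType.
Implicit Types R : seq Gamma -> nat -> nat -> Prop.

Lemma eq_regular_rel R R' :
  (forall s i j, i < size s -> j < size s -> (R s i j <-> R' s i j)) ->
  regular_rel R -> regular_rel R'.
Proof.
move=> RR' [L rL RL]; exists L => // s i j si sj.
by rewrite -RR' // RL.
Qed.

Lemma regular_rel_not R : regular_rel R -> regular_rel (fun s i j => ~ R s i j).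
Proof.
case=> L rL RL; exists (~` L); first exact: regularC.
by move=> s i j si sj; rewrite RL.
Qed.

Lemma regular_rel_and R R' : regular_rel R -> regular_rel R' ->
  regular_rel (fun s i j => R s i j /\ R' s i j).
Proof.
case=> L rL RL [L' rL' RL']; exists (L `&` L'); first exact: regularI.
by move=> s i j si sj; rewrite RL // RL'.
Qed.

Lemma regular_rel_imply R R' : regular_rel R -> regular_rel R' ->
  regular_rel (fun s i j => R s i j -> R' s i j).
Proof.
case=> L rL RL [L' rL' RL']; exists (fun s => L s -> L' s).
  exact: regular_imply.
by move=> s i j si sj; rewrite RL // RL'.
Qed.

Lemma regular_rel_iff R R' : regular_rel R -> regular_rel R' ->
  regular_rel (fun s i j => R s i j <-> R' s i j).
Proof. by move=> rR rR'; apply: regular_rel_and; apply: regular_rel_imply. Qed.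

Lemma regular_rel_swap R : regular_rel R -> regular_rel (fun s i j => R s j i).
Proof.
case=> L rL RL.
exists (fun s => L [seq (x.1.1, x.2, x.1.2) | x <- s]).
  exact: regular_map.
by move=> s i j si sj; rewrite RL // mark_swap.
Qed.

Lemma regular_rel_unary (L : set (seq (Gamma * bool))) :
  regular L -> regular_rel (fun s i _ => L (mark s (pred1 i))).
Proof.
move=> rL; exists (fun s => L (map fst s)); first exact: regular_map.
by move=> s i j _ _; rewrite map_fst_mark.
Qed.

Lemma regular_rel_diag R : regular_rel R -> regular_rel (fun s i _ => R s i i).
Proof.
case=> L rL RL; have := regular_rel_unary (regular_map (fun x => (x, x.2)) rL).
by apply: eq_regular_rel => s i j si _; rewrite RL // mark_diag.
Qed.

Lemma regular_rel_ex R : regular_rel R ->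
  regular_rel (fun s i _ => exists2 k, k < size s & R s i k).
Proof.
case=> L rL RL; have := regular_rel_unary (regular_ex_mark rL).
apply: eq_regular_rel => s i j si _; rewrite size_mark.
by split=> -[k sk Lk]; exists k => //; apply/RL.
Qed.

Lemma regular_forall R : regular_rel R ->
  regular (fun s => forall i, i < size s -> R s i i).
Proof.
case=> L rL RL; have := regularC (regular_ex_mark (regularC
  (regular_map (fun x => (x, x.2)) rL))).
apply: eq_regular => s; split=> [nex i si|all_i [i si]].
  apply/RL => //; rewrite mark_diag; apply: contrapT => nL.
  by apply: nex; exists i.
by apply; rewrite -mark_diag; apply/RL => //; apply: all_i.
Qed.

Lemma regular_rel_label (p : pred Gamma) :
  regular_rel (fun s i _ => oapp p false (onth s i)).
Proof.
have := regular_rel_unary (regular_all (fun x : Gamma * bool => x.2 ==> p x.1)).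
by apply: eq_regular_rel => s i j si _; rewrite all_mark.
Qed.

Lemma regular_rel_between (L : set (seq Gamma)) :
  regular L -> regular_rel (fun s i j => i < j /\ L (between s i j)).
Proof.
move/regularP=> [Q [step [q [p Lp]]]].
(* [None]: no mark seen; [Some (inl r)]: between the marks; [Some (inr b)]:
   verdict [b]. *)
pose scan (o : option (Q + bool)) (x : Gamma * bool * bool) :=
  match o with
  | None => if x.2 then Some (inr false)
            else if x.1.2 then Some (inl q) else None
  | Some (inl r) => Some (if x.2 then inr (p r) else inl (step r x.1.1))
  | Some (inr b) => Some (inr b)
  end.
exists (fun s => foldl scan None s == Some (inr true)).
  exact: (regular_foldl scan None (pred1 (Some (inr true)))).
have verdict b t : foldl scan (Some (inr b)) t = Some (inr b) by elim: t.
have after_first r (s : seq Gamma) k : k < size s ->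
    foldl scan (Some (inl r)) (mark (mark s xpred0) (pred1 k)) =
    Some (inr (p (foldl step r (take k s)))).
  by elim: s r k => [|a s IH] r [|k] //=; rewrite ?verdict // ltnS => /IH->.
elim=> [|a s IH] [|i] [|j] //=; rewrite ?verdict.
- by split=> // -[].
- rewrite ltnS => _ sj; rewrite after_first // /between /= drop0 Lp.
  by split=> [[_ ->]//|/eqP[->]].
- by split=> // -[].
- by rewrite !ltnS => si sj; rewrite -IH.
Qed.

Lemma regular_rel_lt : regular_rel (fun (s : seq Gamma) i j => i < j).
Proof.
have := regular_rel_between (regular_cst Gamma True).
by apply: eq_regular_rel => s i j _ _; split=> [[]|].
Qed.

Lemma regular_rel_eq0 : regular_rel (fun (s : seq Gamma) i _ => i = 0).
Proof.
have := regular_rel_not (regular_rel_ex (regular_rel_swap regular_rel_lt)).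
apply: eq_regular_rel => s [|i] j si _; first by split=> // _ [].
by split=> // nex; case: nex; exists 0 => //; case: (s) si.
Qed.

End RegularRelations.

Lemma regular_relabel (Gamma Gamma' T : finType) (f : Gamma' -> Gamma)
    (L : set (seq (Gamma * T))) :
  regular L -> regular (fun s => L (relabel f s)).
Proof. exact: regular_map. Qed.

Lemma regular_rel_map (Gamma Gamma' : finType) (f : Gamma' -> Gamma) R :
  regular_rel R -> regular_rel (fun s => R (map f s)).
Proof.
case=> L rL RL; pose f' (x : Gamma' * bool) := (f x.1, x.2).
exists (fun s => L (relabel f' s)); first exact: regular_relabel.
by move=> s i j si sj; rewrite RL ?size_map // !map_mark.
Qed.

Lemma regular_rel_relabel (Gamma Gamma' T : finType) (f : Gamma' -> Gamma)
    (R : seq (Gamma * T) -> nat -> nat -> Prop) :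
  regular_rel R -> regular_rel (fun s => R (relabel f s)).
Proof. exact: regular_rel_map. Qed.

(** * Data words and class languages *)

Section Onth.
Variable T : Type.
Implicit Types s : seq T.

Lemma onth_drop s i k : onth (drop i s) k = onth s (i + k).
Proof. by rewrite !onthE map_drop nth_drop. Qed.

Lemma onth_take s j k : onth (take j s) k = if k < j then onth s k else None.
Proof.
rewrite !onthE map_take; case: ltnP => jk; first exact: nth_take.
by rewrite nth_default // size_take_min geq_min jk.
Qed.

Lemma onth_lt s i a : onth s i = Some a -> i < size s.
Proof. by rewrite -onthTE => ->. Qed.

Lemma onth_ex s i : i < size s -> exists a, onth s i = Some a.
Proof. by rewrite -onthTE; case: onth => // a _; exists a. Qed.

Lemma take_onth s i j a : onth s i = Some a -> i < j ->
  take j s = take i s ++ a :: between s i j.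
Proof.
rewrite /between; elim: s i j => [|b s IH] [|i] [|j] //=.
  by case=> ->; rewrite drop0.
by rewrite ltnS => sa ij; rewrite -IH.
Qed.

Lemma onth_takeS s i a : onth s i = Some a -> take i.+1 s = rcons (take i s) a.
Proof.
by move=> si; rewrite (take_nth a) (onth_lt si, onth_nth _ _ _ _ si).
Qed.

Lemma betweenS s i j a : onth s j = Some a -> i < j ->
  between s i j.+1 = rcons (between s i j) a.
Proof.
move=> sj ij; rewrite /between (onth_takeS sj) drop_rcons //.
by rewrite size_takel // ltnW // (onth_lt sj).
Qed.

Lemma between_size s i : between s i (size s) = drop i.+1 s.
Proof. by rewrite /between take_size. Qed.

End Onth.

Lemma map_between T T' (f : T -> T') s i j :
  between (map f s) i j = map f (between s i j).
Proof. by rewrite /between -map_take -map_drop. Qed.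

Section DataWords.
Variable D : Type.

Definition class_word B (v : seq (B * D)) (d : D) : seq (B * bool) :=
  [seq (x.1, `[< x.2 = d >]) | x <- v].

Definition marked B (s : seq (B * bool)) i : bool := oapp snd false (onth s i).

Definition class_language B (C : set (seq (B * bool))) : set (seq (B * D)) :=
  [set v | forall d, C (class_word v d)].

Definition seen B (v : seq (B * D)) (d : D) : bool :=
  has (fun x => `[< x.2 = d >]) v.

Lemma labelP B (v : seq (B * D)) i b :
  onth (map fst v) i = Some b <-> exists d, onth v i = Some (b, d).
Proof.
rewrite onth_map; split=> [|[d ->]] //.
by case: onth => [[b' d]|] //= [->]; exists d.
Qed.

Lemma class_word_relabel B B' (f : B -> B') v d :
  class_word (relabel f v) d = relabel f (class_word v d).
Proof. by rewrite /class_word /relabel -!map_comp. Qed.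

Lemma class_language_relabel B B' (f : B -> B') (C : set (seq (B' * bool))) v :
  class_language C (relabel f v) <->
  class_language (fun s => C (relabel f s)) v.
Proof. by split=> Cv d; have := Cv d; rewrite class_word_relabel. Qed.

Lemma unseen_class_word B (v : seq (B * D)) d :
  ~~ seen v d -> class_word v d = [seq (b, false) | b <- map fst v].
Proof. by elim: v => //= x v IH; rewrite negb_or => /andP[/negbTE-> /IH->]. Qed.

Lemma unseenE B (v : seq (B * D)) d :
  ~~ seen v d = all (fun x => ~~ x.2) (class_word v d).
Proof. by rewrite /seen -all_predC all_map. Qed.

Lemma fresh_datum B (v : seq (B * D)) :
  infinite_set [set: D] -> exists d, ~~ seen v d.
Proof.
move=> infD; pose data : seq {classic D} := map snd v.
have [d [_ dv]] := infinite_setN0 (infinite_setD infD (finite_seq data)).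
exists d; apply/negP => seen_d; apply: dv => /=.
rewrite -has_pred1 has_map; apply: sub_has seen_d => x /asboolP xd.
exact/eqP.
Qed.

Section Positions.
Variable B : finType.
Implicit Types (v : seq (B * D)) (d : D) (i j k : nat).

Lemma has_datum_relabel (B' : finType) (f : B -> B') v :
  has_datum (relabel f v) = has_datum v.
Proof.
apply/funext => d; apply/funext => i; apply/propext.
rewrite /has_datum onth_relabel; case: (onth v i) => [[b d']|] /=; last first.
  by split=> -[].
by split=> -[a [_ <-]]; [exists b|exists (f b)].
Qed.

Lemma same_data_relabel (B' : finType) (f : B -> B') v :
  same_data (relabel f v) = same_data v.
Proof. by rewrite /same_data has_datum_relabel. Qed.

Lemma class_succ_relabel (B' : finType) (f : B -> B') v :
  class_succ (relabel f v) = class_succ v.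
Proof. by rewrite /class_succ same_data_relabel. Qed.

Lemma has_datum_class_word v d i :
  has_datum v d i <-> marked (class_word v d) i.
Proof.
rewrite /has_datum /marked onth_map.
case: (onth v i) => [[b d']|] /=; last by split=> // -[].
by split=> [[a [_ ->]]|/asboolP->]; [apply/asboolP|exists b].
Qed.

Lemma has_datum_ex v i : i < size v -> exists d, has_datum v d i.
Proof. by move=> vi; have [[b d] vbd] := onth_ex vi; exists d, b. Qed.

Lemma has_datum_lt v d i : has_datum v d i -> i < size v.
Proof. by case=> b vb; apply: onth_lt vb. Qed.

Lemma has_datum_inj v d d' i : has_datum v d i -> has_datum v d' i -> d = d'.
Proof. by move=> [a e] [a']; rewrite e => -[_ ->]. Qed.

Lemma same_dataP v d i j : has_datum v d i \/ has_datum v d j ->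
  (same_data v i j <-> has_datum v d i /\ has_datum v d j).
Proof.
move=> vd; split=> [[d' vi vj]|[vi vj]]; last by exists d.
by case: vd => [/(has_datum_inj vi)<-|/(has_datum_inj vj)<-].
Qed.

Lemma seenP v d : seen v d <-> exists i, has_datum v d i.
Proof.
elim: v => [|[b d'] v IH] /=; first by split=> // -[i [b]]; rewrite onth0n.
split=> [/orP[/asboolP->|/IH[i vi]]|[[|i]]]; first by exists 0, b.
- by exists i.+1.
- by case=> b' [_ ->]; rewrite asboolT.
- by move=> vi; apply/orP; right; apply/IH; exists i.
Qed.

Lemma seen_take v d j :
  seen (take j v) d <-> exists2 k, k < j & has_datum v d k.
Proof.
rewrite seenP /has_datum; split=> [[k]|[k kj [b vk]]]; last first.
  by exists k, b; rewrite onth_take kj.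
by rewrite onth_take; case: ltnP => [kj|_ []//]; exists k.
Qed.

Lemma seen_drop v d i :
  seen (drop i v) d <-> exists2 k, i <= k & has_datum v d k.
Proof.
rewrite seenP /has_datum; split=> [[k]|[k ik [b vk]]].
  by rewrite onth_drop; exists (i + k); rewrite ?leq_addr.
by exists (k - i), b; rewrite onth_drop subnKC.
Qed.

Lemma seen_between v d i j :
  seen (between v i j) d <-> exists2 k, i < k < j & has_datum v d k.
Proof.
rewrite /between seen_drop /has_datum; split=> [[k ik]|[k /andP[ik kj] vk]].
  rewrite onth_take; case: ltnP => [kj vk|_ []//].
  by exists k; rewrite ?ik.
by exists k => //; rewrite onth_take kj.
Qed.

Lemma class_succP v d i j : has_datum v d i \/ has_datum v d j ->
  (class_succ v i j <->
   [/\ i < j, has_datum v d i, has_datum v d j & ~~ seen (between v i j) d]).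
Proof.
move=> vd; rewrite /class_succ (propext (same_dataP vd)).
split=> [[ij [vi vj] nij]|[ij vi vj nij]]; split=> //.
  apply/negP => /seen_between[k /nij + vk]; apply.
  exact/(same_dataP (or_introl vi)).
move=> k ikj /(same_dataP (or_introl vi))[_ vk].
by move/negP: nij; apply; apply/seen_between; exists k.
Qed.

Lemma unseen_or_last v d j :
  ~~ seen (take j v) d \/
  exists i, [/\ i < j, has_datum v d i & ~~ seen (between v i j) d].
Proof.
have [/seen_take[k kj vk]|] := boolP (seen (take j v) d); last by left.
have ub i : (i < j) && `[< has_datum v d i >] -> i <= j by case/andP=> /ltnW.
have ex : exists i, (i < j) && `[< has_datum v d i >].
  by exists k; rewrite kj; apply/asboolP.
case: (ex_maxnP ex ub) => i /andP[ij /asboolP vi] imax.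
right; exists i; split=> //.
apply/negP => /seen_between[l /andP[il lj] vl].
by have := imax l; rewrite lj asboolT // leqNgt il => /(_ isT).
Qed.

End Positions.

Definition class_recognizable (Sigma : finType)
    (L : data_language Sigma D) : Prop :=
  exists (B : finType) (f : B -> Sigma) (C : set (seq (B * bool))),
    regular C /\ L = relabel f @` class_language C.

Lemma class_recognizable_relabel (Sigma Sigma' : finType) (f : Sigma -> Sigma')
    (L : data_language Sigma D) :
  class_recognizable L -> class_recognizable (relabel f @` L).
Proof.
move=> [B [g [C [rC ->]]]]; exists B, (f \o g), C; split=> //.
rewrite image_comp; congr (_ @` _).
by apply/funext => v; rewrite /= relabel_comp.
Qed.

End DataWords.

(** * From formulas to class languages *)

Lemma regular_rel_marked (B : finType) :
  regular_rel (fun (s : seq (B * bool)) i _ => marked s i).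
Proof. exact: regular_rel_label. Qed.

Definition regular_on_classes (D : Type) (B : finType) (K : set (seq (B * D)))
    (Phi : seq (B * D) -> nat -> nat -> Prop) : Prop :=
  exists2 R, regular_rel R &
    forall v i j d, K v -> i < size v -> j < size v ->
      has_datum v d i \/ has_datum v d j ->
      (Phi v i j <-> R (class_word v d) i j).

Section RegularOnClasses.
Variables (D : Type) (B : finType) (K : set (seq (B * D))).
Implicit Types Phi : seq (B * D) -> nat -> nat -> Prop.

Lemma eq_regular_on_classes Phi Phi' :
  (forall v i j, i < size v -> j < size v -> (Phi v i j <-> Phi' v i j)) ->
  regular_on_classes K Phi -> regular_on_classes K Phi'.
Proof.
move=> PhiE [R rR PhiR]; exists R => // v i j d Kv vi vj vd.
by rewrite -PhiE // (PhiR v i j d).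
Qed.

Lemma regular_on_classes_not Phi : regular_on_classes K Phi ->
  regular_on_classes K (fun v i j => ~ Phi v i j).
Proof.
case=> R rR PhiR; exists (fun s i j => ~ R s i j).
  exact: regular_rel_not.
by move=> v i j d Kv vi vj vd; rewrite (PhiR v i j d).
Qed.

Lemma regular_on_classes_and Phi Phi' :
  regular_on_classes K Phi -> regular_on_classes K Phi' ->
  regular_on_classes K (fun v i j => Phi v i j /\ Phi' v i j).
Proof.
case=> R rR PhiR [R' rR' PhiR']; exists (fun s i j => R s i j /\ R' s i j).
  exact: regular_rel_and.
by move=> v i j d Kv vi vj vd; rewrite (PhiR v i j d) // (PhiR' v i j d).
Qed.

Lemma regular_on_classes_swap Phi : regular_on_classes K Phi ->
  regular_on_classes K (fun v i j => Phi v j i).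
Proof.
case=> R rR PhiR; exists (fun s i j => R s j i); first exact: regular_rel_swap.
by move=> v i j d Kv vi vj vd; apply: PhiR => //; rewrite orC.
Qed.

Lemma regular_on_classes_relabel (B' : finType) (f : B' -> B)
    (K' : set (seq (B' * D))) Phi :
  (forall v, K' v -> K (relabel f v)) -> regular_on_classes K Phi ->
  regular_on_classes K' (fun v => Phi (relabel f v)).
Proof.
move=> K'K [R rR PhiR]; exists (fun s => R (relabel f s)).
  exact: regular_rel_relabel.
move=> v i j d /K'K Kv vi vj vd.
rewrite (PhiR _ i j d) ?size_map ?class_word_relabel //.
by rewrite !has_datum_relabel.
Qed.

End RegularOnClasses.

(* [C] tells whether the advice in [P], added to the letters, is correct. *)
Definition advice_language (D : Type) (G P : finType)
    (C : set (seq (G * P * bool))) : Prop :=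
  regular C /\
  forall u : seq (G * D), exists2 v, relabel fst v = u & class_language C v.

Definition advisable (D : Type) (G : finType)
    (Phi : seq (G * D) -> nat -> nat -> Prop) : Prop :=
  exists (P : finType) (C : set (seq (G * P * bool))), advice_language D C /\
    regular_on_classes (class_language C) (fun v => Phi (relabel fst v)).

Definition on_advice G P P' (h : P -> P') (x : G * P) : G * P' := (x.1, h x.2).

Lemma relabel_on_advice T G P P' (h : P -> P') (v : seq (G * P * T)) :
  relabel fst (relabel (on_advice h) v) = relabel fst v.
Proof. by rewrite relabel_comp. Qed.

Section Advisable.
Variables (D : Type) (G : finType).
Implicit Types (Phi : seq (G * D) -> nat -> nat -> Prop) (u : seq (G * D)).

Lemma eq_advisable Phi Phi' :
  (forall u i j, i < size u -> j < size u -> (Phi u i j <-> Phi' u i j)) ->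
  advisable Phi -> advisable Phi'.
Proof.
move=> PhiE [P [C [adviceC rPhi]]]; exists P, C; split=> //.
apply: eq_regular_on_classes rPhi => v i j vi vj.
by apply: PhiE; rewrite size_map.
Qed.

Lemma regular_on_classes_advisable Phi :
  regular_on_classes setT Phi -> advisable Phi.
Proof.
move=> rPhi; exists unit, setT; split; last first.
  exact: regular_on_classes_relabel rPhi.
split=> [|u]; first exact: regular_cst.
exists (relabel (fun g => (g, tt)) u) => //.
by rewrite relabel_comp /relabel; elim: u => //= -[g d] u {2}<-.
Qed.

Lemma advisable_not Phi : advisable Phi -> advisable (fun u i j => ~ Phi u i j).
Proof.
move=> [P [C [adviceC rPhi]]]; exists P, C; split=> //.
exact: regular_on_classes_not.
Qed.

Lemma advisable_swap Phi : advisable Phi -> advisable (fun u i j => Phi u j i).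
Proof.
move=> [P [C [adviceC rPhi]]]; exists P, C; split=> //.
exact: regular_on_classes_swap rPhi.
Qed.

Lemma regular_on_classes_advice (P P' : finType) (h : P' -> P)
    (K : set (seq (G * P * D))) (K' : set (seq (G * P' * D))) Phi :
  (forall v, K' v -> K (relabel (on_advice h) v)) ->
  regular_on_classes K (fun v => Phi (relabel fst v)) ->
  regular_on_classes K' (fun v => Phi (relabel fst v)).
Proof.
move=> K'K /(regular_on_classes_relabel K'K).
by apply: eq_regular_on_classes => v i j _ _; rewrite relabel_on_advice.
Qed.

Lemma relabel_pair P P' (v : seq (G * P * D)) (v' : seq (G * P' * D)) :
  relabel fst v = relabel fst v' ->
  exists2 t : seq (G * (P * P') * D),
    relabel (on_advice fst) t = v & relabel (on_advice snd) t = v'.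
Proof.
elim: v v' => [|[[g p] d] v IH] [|[[g' p'] d'] v'] //=; first by exists [::].
by case=> <- <- /IH[t <- <-]; exists ((g, (p, p'), d) :: t).
Qed.

Lemma advisable_and Phi Phi' : advisable Phi -> advisable Phi' ->
  advisable (fun u i j => Phi u i j /\ Phi' u i j).
Proof.
move=> [P [C [[rC exC] rPhi]]] [P' [C' [[rC' exC'] rPhi']]].
pose both : set (seq (G * (P * P') * bool)) :=
  [set s | C (relabel (on_advice fst) s) /\ C' (relabel (on_advice snd) s)].
have bothE (v : seq (G * (P * P') * D)) : class_language both v <->
    class_language C (relabel (on_advice fst) v) /\
    class_language C' (relabel (on_advice snd) v).
  rewrite !class_language_relabel; split=> [both_v|[Cv C'v] d].
    by split=> d; have [] := both_v d.
  by split; [apply: Cv|apply: C'v].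
exists (P * P')%type, both; split; first split.
- by apply: regularI; apply: regular_relabel.
- move=> u; have [v vu Cv] := exC u; have [v' v'u C'v'] := exC' u.
  have [|t tv tv'] := @relabel_pair _ _ v v'; first by rewrite vu.
  exists t; first by rewrite -vu -tv relabel_on_advice.
  by apply/bothE; rewrite tv tv'.
- apply: regular_on_classes_and.
    by apply: (regular_on_classes_advice (h := fst)) rPhi => v /bothE[].
  by apply: (regular_on_classes_advice (h := snd)) rPhi' => v /bothE[].
Qed.

Definition advice_bit T P (s : seq (G * (P * bool) * T)) i : bool :=
  oapp (fun x => x.1.2.2) false (onth s i).

Lemma relabel_bit T P (v : seq (G * P * T)) (b : nat -> bool) :
  exists2 t : seq (G * (P * bool) * T), relabel (on_advice fst) t = v &
    forall i, i < size v -> advice_bit t i = b i.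
Proof.
elim: v b => [|[[g p] d] v IH] b; first by exists [::].
have [t <- tb] := IH (fun i => b i.+1).
by exists ((g, (p, b 0), d) :: t) => // -[|i] //; apply: tb.
Qed.

Lemma advice_bit_class_word P (v : seq (G * (P * bool) * D)) d i :
  advice_bit (class_word v d) i = advice_bit v i.
Proof. by rewrite /advice_bit onth_map; case: onth. Qed.

(* The bit is checked at the marked positions only, that is, on the class words
   of their own datum, but can be read at all positions of all class words. *)
Definition checked_bit (P : finType) (C : set (seq (G * P * bool)))
    (S : seq (G * P * bool) -> nat -> nat -> Prop) :
    set (seq (G * (P * bool) * bool)) :=
  [set s | C (relabel (on_advice fst) s) /\
    forall i, i < size s -> marked s i ->
      (advice_bit s i <-> S (relabel (on_advice fst) s) i i)].

Lemma regular_checked_bit (P : finType) (C : set (seq (G * P * bool))) S :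
  regular C -> regular_rel S -> regular (checked_bit C S).
Proof.
move=> rC rS; apply: regularI; first exact: regular_relabel.
pose S' (s : seq (G * (P * bool) * bool)) := S (relabel (on_advice fst) s).
apply: (regular_forall
  (R := fun s i _ => marked s i -> (advice_bit s i <-> S' s i i))).
apply: regular_rel_imply; first exact: regular_rel_marked.
apply: (regular_rel_iff (R' := fun s i _ => S' s i i)).
  exact: regular_rel_label.
by apply: regular_rel_diag; apply: regular_rel_relabel.
Qed.

Lemma advisable_own_class (P : finType) (C : set (seq (G * P * bool)))
    (Psi : seq (G * D) -> nat -> Prop) S :
  advice_language D C -> regular_rel S ->
  (forall v i d, class_language C v -> has_datum v d i ->
     (Psi (relabel fst v) i <-> S (class_word v d) i i)) ->
  advisable (fun u i _ => Psi u i).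
Proof.
move=> [rC exC] rS PsiS.
have PsiE v d i :
    class_language C (relabel (on_advice fst) v) -> has_datum v d i ->
    (Psi (relabel fst v) i <->
     S (relabel (on_advice (fst : P * bool -> P)) (class_word v d)) i i).
  move=> Cv vd; rewrite -class_word_relabel -PsiS ?has_datum_relabel //.
  by rewrite relabel_on_advice.
exists (P * bool)%type, (checked_bit C S); split; first split.
- exact: regular_checked_bit.
- move=> u; have [v <- Cv] := exC u.
  have [t tv tb] := relabel_bit v (fun i => `[< Psi (relabel fst v) i >]).
  exists t; first by rewrite -tv relabel_on_advice.
  move=> d; split; first by rewrite -class_word_relabel tv.
  move=> i; rewrite size_map => ti /has_datum_class_word td.
  rewrite advice_bit_class_word tb -?tv ?size_map // asboolE relabel_on_advice.
  by apply: PsiE; rewrite ?tv.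
- exists (fun s i _ => advice_bit s i); first exact: regular_rel_label.
  move=> v i j d bit_v vi _ _; have [d0 vd0] := has_datum_ex vi.
  have Cv : class_language C (relabel (on_advice fst) v).
    by apply/class_language_relabel => d'; have [] := bit_v d'.
  have [_ checked] := bit_v d0.
  rewrite (PsiE v d0) // -checked ?size_map //; last exact/has_datum_class_word.
  by rewrite !advice_bit_class_word.
Qed.

Lemma advisable_ex Phi : advisable Phi ->
  advisable (fun u i _ => exists2 k, k < size u & Phi u i k).
Proof.
move=> [P [C [adviceC [R rR PhiR]]]].
pose Psi u i := exists2 k, k < size u & Phi u i k.
apply: (advisable_own_class (Psi := Psi) adviceC (regular_rel_ex rR)).
move=> v i d Cv vd.
rewrite /Psi !size_map; have vi := has_datum_lt vd.
by split=> -[k vk Phik]; exists k => //;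
  move: Phik; rewrite (PhiR v i k d) //; left.
Qed.

(* [Phi] is evaluated at the first position, on the class word of its datum. *)
Lemma advisable_class_recognizable Phi (holds_on_nil : Prop) :
  infinite_set [set: D] -> advisable Phi -> class_recognizable
    [set u : seq (G * D) | if u is [::] then holds_on_nil else Phi u 0 0].
Proof.
move=> infD [P [C [[rC exC] [R rR PhiR]]]].
pose C' : set (seq (G * P * bool)) := C `&` [set s |
  (s = [::] -> holds_on_nil) /\
  forall i, i < size s -> i = 0 -> marked s i -> R s i i].
have C'E (v : seq (G * P * D)) : class_language C v ->
    (if v is [::] then holds_on_nil else Phi (relabel fst v) 0 0) <->
    class_language C' v.
  case: v => [|[b d] v] Cv.
    split=> [nil_ok d|C'v]; first by split; [apply: Cv|split].
    have [d _] := infinite_setN0 infD.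
    by have [_ [nil_ok _]] := C'v d; apply: nil_ok.
  have vd : has_datum ((b, d) :: v) d 0 by exists b.
  rewrite (PhiR _ 0 0 d) //; last by left.
  split=> [R00 d'|C'v]; last first.
    have [_ [_ R_first]] := C'v d.
    by apply: R_first => //; apply/has_datum_class_word.
  split; first exact: Cv.
  split=> // i _ -> /has_datum_class_word vd'.
  by rewrite (has_datum_inj vd' vd).
exists (G * P)%type, fst, C'; split.
  apply: regularI => //; apply: regularI.
    by apply: regular_imply; [apply: regular_nil|apply: regular_cst].
  apply: (regular_forall (R := fun s i _ => i = 0 -> marked s i -> R s i i)).
  apply: regular_rel_imply; first exact: regular_rel_eq0.
  by apply: regular_rel_imply;
    [apply: regular_rel_marked|apply: regular_rel_diag].
apply/seteqP; split=> u /=.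
  have [v <- Cv] := exC u => Phi_u; exists v => //; apply/(C'E v Cv).
  by case: v Phi_u {Cv} => [|[? ?] ?].
move=> [v C'v <-]; have [_ /(_ C'v)] := C'E v (fun d => (C'v d).1).
by case: (v) => [|[? ?] ?].
Qed.

End Advisable.

Definition env (i j : nat) (t : var) : nat := if t is vx then i else j.

Section Formulas.
Variables (D : Type) (Sigma : finType) (n : nat).
Local Notation G := (ext_letter Sigma n).
Implicit Types u : seq (G * D).

Definition ext_sets u : 'I_n -> set nat :=
  fun k i => oapp (fun g : G => k \in g.2) false (onth (map fst u) i).

Definition models u (e : var -> nat) (phi : fo2 Sigma n) : Prop :=
  sat (relabel fst u) (ext_sets u) e phi.

Lemma ext_word_ext_sets u : ext_word (ext_sets u) (relabel fst u) = map fst u.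
Proof.
rewrite /ext_word; suff ext_word_from m (X : 'I_n -> set nat) :
    (forall k i, X k (m + i) <-> ext_sets u k i) ->
    [seq (p.1.1, [set k | p.2 \in X k]%SET) |
       p <- zip (relabel fst u) (iota m (size (relabel fst u)))] = map fst u.
  exact: ext_word_from.
elim: u m X => [|[[a S] d] u IH] m X XP //=; congr (_ :: _).
  congr (_, _); apply/setP => k; rewrite inE.
  by apply/idP/idP; rewrite inE => /=; have := XP k 0; rewrite addn0 => ->.
by apply: IH => k i; rewrite addSnnS XP.
Qed.

Lemma ext_sets_sub u k : ext_sets u k `<=` [set i | i < size (relabel fst u)].
Proof.
move=> i; rewrite /ext_sets /= size_map -(size_map fst) -onthTE.
by case: onth.
Qed.

Lemma ext_sets_ex (w : data_word Sigma D) (X : 'I_n -> set nat) :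
  (forall k, X k `<=` [set i | i < size w]) ->
  exists2 u, relabel fst u = w & ext_sets u = X.
Proof.
elim: w X => [|[a d] w IH] X XP.
  exists [::] => //; apply/funext => k; apply/funext => i; apply/propext.
  by rewrite /ext_sets onth0n; split=> // /(XP k i).
have [|u <- uX] := IH (fun k i => X k i.+1); first by move=> k i /(XP k i.+1).
exists ((a, [set k | 0 \in X k]%SET, d) :: u) => //.
apply/funext => k; apply/funext => -[|i]; last first.
  by rewrite -[RHS](congr1 (fun X' => X' k i) uX).
by apply/propext; rewrite /ext_sets /= inE; split; rewrite inE.
Qed.

End Formulas.

Lemma emso2_languageE (D : Type) (Sigma : finType) (phi : emso2 Sigma) :
  emso2_language phi =
  relabel fst @` [set u | models u (fun=> 0) (matrix phi)]
  :> data_language Sigma D.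
Proof.
apply/seteqP; split=> w /= [].
  by move=> X [/ext_sets_ex[u <- <-] sat_u]; exists u.
move=> u sat_u <-; exists (ext_sets u); split=> // k.
exact: ext_sets_sub.
Qed.

Section AdvisableFormulas.
Variables (D : Type) (Sigma : finType) (n : nat).
Local Notation G := (ext_letter Sigma n).
Implicit Types u : seq (G * D).

Lemma advisable_label (p : pred G) :
  advisable (fun u i _ => oapp p false (onth (map fst u) i)).
Proof.
apply: regular_on_classes_advisable.
exists (fun s i _ => oapp (fun x : G * bool => p x.1) false (onth s i)).
  exact: regular_rel_label.
by move=> u i j d _ _ _ _; rewrite !onth_map; case: onth.
Qed.

Lemma advisable_between (L : set (seq G)) : regular L ->
  advisable (fun u i j => i < j /\ L (between (map fst u) i j)).
Proof.
move=> rL; apply: regular_on_classes_advisable.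
exists (fun s i j => i < j /\ L (between (map fst s) i j)).
  exact: (regular_rel_map fst (regular_rel_between rL)).
by move=> u i j d _ _ _ _; rewrite /class_word -map_comp.
Qed.

Lemma advisable_lt : advisable (fun u i j => i < j).
Proof.
apply: eq_advisable (advisable_between (regular_cst G True)) => u i j _ _.
by split=> [[]|].
Qed.

Lemma advisable_eq : advisable (fun u i j => i = j).
Proof.
have := advisable_and (advisable_not advisable_lt)
  (advisable_not (advisable_swap advisable_lt)).
apply: eq_advisable => u i j _ _.
split=> [[/negP + /negP]|->]; last by rewrite ltnn.
by rewrite -!leqNgt => ji ij; apply/eqP; rewrite eqn_leq ij ji.
Qed.

Lemma advisable_succ : advisable (fun u i j => succ_pos (relabel fst u) i j).
Proof.
apply: eq_advisable (advisable_between (regular_nil G)) => u i j _ uj.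
have szE : size (between (map fst u) i j) = j - i.+1.
  by rewrite /between size_drop size_takel // size_map ltnW.
rewrite /succ_pos size_map; split=> [[ij /nilP]|[_ ji]].
  rewrite /nilp szE subn_eq0 => ji.
  by split=> //; apply/eqP; rewrite eqn_leq ij ji.
by split; [rewrite ji|apply/nilP; rewrite /nilp szE ji subnn].
Qed.

Lemma advisable_same_data :
  advisable (fun u i j => same_data (relabel fst u) i j).
Proof.
apply: regular_on_classes_advisable.
exists (fun s i j => marked s i /\ marked s j).
  by apply: regular_rel_and; [|apply: regular_rel_swap];
    apply: regular_rel_marked.
move=> u i j d _ _ _ ud.
by rewrite same_data_relabel -!has_datum_class_word (same_dataP ud).
Qed.

Lemma advisable_class_succ :
  advisable (fun u i j => class_succ (relabel fst u) i j).
Proof.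
apply: regular_on_classes_advisable.
exists (fun s i j => (marked s i /\ marked s j) /\
    (i < j /\ all (fun x => ~~ x.2) (between s i j))).
  apply: regular_rel_and; last exact: regular_rel_between (regular_all _).
  by apply: regular_rel_and; [|apply: regular_rel_swap];
    apply: regular_rel_marked.
move=> u i j d _ _ _ ud.
rewrite class_succ_relabel (class_succP ud) -!has_datum_class_word.
rewrite map_between -unseenE.
by split=> [[]|[[]] + + []].
Qed.

Lemma advisable_vars (Phi : seq (G * D) -> nat -> nat -> Prop) s t :
  advisable Phi -> advisable (fun u i j => Phi u (env i j s) (env i j t)).
Proof.
move=> aPhi.
have diag : advisable (fun u i _ => Phi u i i).
  apply: eq_advisable (advisable_ex (advisable_and advisable_eq aPhi)).
  by move=> u i j ui _; split=> [[k _ [<-]]//|Pii]; exists i.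
by case: s t => -[] //=; [apply: advisable_swap|apply: advisable_swap diag].
Qed.

Lemma advisable_models_ex (phi : fo2 Sigma n) t :
  advisable (fun u i j => models u (env i j) phi) ->
  advisable (fun u i j => models u (env i j) (FEx t phi)).
Proof.
have updE i j k : update (env i j) t k = if t is vx then env k j else env i k.
  by case: t; apply/funext => -[].
case: t updE => updE aphi.
  apply: eq_advisable (advisable_swap (advisable_ex (advisable_swap aphi))).
  move=> u i j _ _; rewrite /models /= size_map.
  by split=> -[k uk phik]; exists k => //; move: phik; rewrite updE.
apply: eq_advisable (advisable_ex aphi).
move=> u i j _ _; rewrite /models /= size_map.
by split=> -[k uk phik]; exists k => //; move: phik; rewrite updE.
Qed.

Lemma advisable_models (phi : fo2 Sigma n) :
  advisable (fun u i j => models u (env i j) phi).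
Proof.
rewrite /models; elim: phi => [a t|k t|s t|s t|s t|s t|s t|L rL s t|f IH
  |f IHf g IHg|f IHf g IHg|t f IH|t f IH] /=.
- apply: (@advisable_vars (fun u i _ => has_letter (relabel fst u) a i) t t).
  apply: eq_advisable (advisable_label (fun g => g.1 == a)) => u i j _ _.
  rewrite /has_letter !onth_map.
  case: onth => [[[a' S] d]|] /=; last by split=> // -[].
  by split=> [/eqP->|[? [->]]]; first by exists d.
- apply: (@advisable_vars (fun u i _ => ext_sets u k i) t t).
  exact: advisable_label.
- exact: (@advisable_vars (fun _ i j => i = j) s t advisable_eq).
- exact: (@advisable_vars (fun _ i j => i < j) s t advisable_lt).
- exact: (advisable_vars s t advisable_succ).
- exact: (advisable_vars s t advisable_same_data).
- exact: (advisable_vars s t advisable_class_succ).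
- apply: eq_advisable (advisable_vars s t (advisable_between rL)) => u i j _ _.
  by rewrite ext_word_ext_sets.
- exact: advisable_not.
- exact: advisable_and.
- have := advisable_not (advisable_and (advisable_not IHf) (advisable_not IHg)).
  by apply: eq_advisable => u i j _ _; rewrite -not_orE notK.
- exact: advisable_models_ex.
- have := advisable_not (@advisable_models_ex (FNot f) t (advisable_not IH)).
  apply: eq_advisable => u i j _ _; rewrite /models /=.
  split=> [nex k uk|all_k [k uk]]; last by apply; apply: all_k.
  by apply: contrapT => nf; apply: nex; exists k.
Qed.

End AdvisableFormulas.

Lemma emso2_class_recognizable (D : Type) (Sigma : finType)
    (phi : emso2 Sigma) :
  infinite_set [set: D] ->
  class_recognizable (emso2_language phi : data_language Sigma D).
Proof.
move=> infD; rewrite emso2_languageE; case: phi => n phi _ /=.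
apply: class_recognizable_relabel.
have := advisable_class_recognizable (models (D := D) [::] (fun=> 0) phi) infD
  (advisable_models D phi).
congr class_recognizable; apply/funext => -[|x u] //.
by congr models; apply/funext => -[].
Qed.

(** * From set automata to class languages *)

Definition null_vec (Y : finType) : bvec Y := [ffun=> false].

(* [z] is the characteristic vector of some datum, and [m] tells whether it is
   the datum read. *)
Definition update_vec (Y : finType) (rho : brel Y) (u v : bvec Y) (z : bvec Y)
    (m : bool) : bvec Y :=
  [ffun y => ([exists x, ((x, y) \in rho) && z x] || m && u y)
             && ~~ (m && v y)].

Section CharacteristicVectors.
Variables (D : Type) (Sigma : finType) (A : set_automaton Sigma).
Local Notation Y := (sa_name A).

Lemma char_vec_null (X : Y -> set D) d :
  char_vec X d = null_vec Y <-> ~ exists y, X y d.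
Proof.
split=> [/ffunP c0 [y Xy]|nX].
  by have := c0 y; rewrite !ffunE => /negbT/negP; apply; rewrite inE.
apply/ffunP => y; rewrite !ffunE; apply/negP; rewrite inE => Xy.
by apply: nX; exists y.
Qed.

Lemma char_vec_update rho u v d (X : Y -> set D) d' :
  char_vec (set_update rho u v d X) d' =
  update_vec rho u v (char_vec X d') `[< d = d' >].
Proof.
apply/ffunP => y; rewrite !ffunE.
have datumE b : data_if b d d' <-> `[< d = d' >] && b.
  case: b; rewrite ?andbT ?andbF //=.
  by split=> [->|/asboolP//]; apply/asboolP.
have movedE : (\bigcup_(x in [set x | (x, y) \in rho]) X x) d' <->
    [exists x, ((x, y) \in rho) && char_vec X d' x].
  split=> [[x /= xy Xx]|/existsP[x /andP[xy]]].
    by apply/existsP; exists x; rewrite xy ffunE inE.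
  by rewrite ffunE inE; exists x.
apply/idP/andP; rewrite inE => -[Xy vy]; split; try by apply/negP => /datumE.
- by case: Xy => [/movedE->//|/datumE->]; rewrite orbT.
- by case/orP: Xy => [/movedE|/datumE]; [left|right].
- by move/datumE; apply/negP.
Qed.

Lemma accepting_char_vec (c : config D A) : accepting c <->
  c.1 \in sa_final A /\
  forall d, (char_vec c.2 d == null_vec Y) || (char_vec c.2 d \in sa_acc A).
Proof.
split=> -[cF acc]; split=> // d; last first.
  by move=> cd; have /orP[/eqP/char_vec_null/(_ cd)|] := acc d.
by case: eqP => //= /char_vec_null; rewrite notK => /acc.
Qed.

End CharacteristicVectors.

Section SetAutomataToClassLanguages.
Variables (D : Type) (Sigma : finType) (A : set_automaton Sigma).
Local Notation Q := (sa_state A).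
Local Notation Y := (sa_name A).

Definition transition : finType := {t | t \in sa_delta A}.
Implicit Types (t : transition) (z : bvec Y) (S : {set Q}) (d : D).

Definition source t : Q := let: (p, _, _, _, _, _, _) := val t in p.
Definition letter t : Sigma := let: (_, a, _, _, _, _, _) := val t in a.
Definition test t : bvec Y := let: (_, _, z, _, _, _, _) := val t in z.
Definition target t : Q := let: (_, _, _, _, _, _, q) := val t in q.
Definition transition_sets t d : (Y -> set D) -> Y -> set D :=
  let: (_, _, _, rho, u, v, _) := val t in set_update rho u v d.
Definition transition_vec t : bvec Y -> bool -> bvec Y :=
  let: (_, _, _, rho, u, v, _) := val t in update_vec rho u v.

Lemma char_vec_transition t d X d' :
  char_vec (transition_sets t d X) d' =
  transition_vec t (char_vec X d') `[< d = d' >].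
Proof.
by case: t => -[[[[[[p a] z] rho] u] v] q] tD; apply: char_vec_update.
Qed.

Lemma sa_stepP (c c' : config D A) a d : sa_step c (a, d) c' <->
  exists t, [/\ letter t = a, source t = c.1, test t = char_vec c.2 d &
                c' = (target t, transition_sets t d c.2)].
Proof.
split=> [[rho [u [v [tD c'E]]]]|[[t tD] []]].
  exists (exist (fun x => x \in sa_delta A) _ tD); split=> //.
  by rewrite /transition_sets /= -c'E -surjective_pairing.
case: t tD => [[[[[[p b] z] rho] u] v] q] tD /= <- pE zE ->.
by exists rho, u, v; rewrite -pE -zE.
Qed.

(* What a class word tells: the states that can have been reached (none once a
   test of the marked datum has failed), and the characteristic vector of that
   datum. *)
Definition profile_step (r : {set Q} * bvec Y) (x : transition * bool) :
    {set Q} * bvec Y :=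
  let: (t, m) := x in
  ((if (source t \in r.1) && (m ==> (test t == r.2)) then [set target t]
    else finset.set0)%SET,
   transition_vec t r.2 m).

Definition profile_accepting (r : {set Q} * bvec Y) : bool :=
  [exists q in r.1, q \in sa_final A] &&
  ((r.2 == null_vec Y) || (r.2 \in sa_acc A)).

Lemma profile_dead s z :
  ~~ profile_accepting (foldl profile_step (finset.set0, z) s).
Proof.
elim: s z => [|[t m] s IH] z /=; last by rewrite inE /=; apply: IH.
by rewrite negb_and; apply/orP; left; apply/existsP => -[q]; rewrite inE.
Qed.

Definition profiles_accepted S (X : Y -> set D)
    (v : seq (transition * D)) : Prop :=
  forall d, profile_accepting
    (foldl profile_step (S, char_vec X d) (class_word v d)).

Lemma profiles_accepted_cons S X t d v :
  profiles_accepted S X ((t, d) :: v) <->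
  [/\ source t \in S, test t = char_vec X d &
      profiles_accepted [set target t]%SET (transition_sets t d X) v].
Proof.
split=> [acc|[tS tz acc] d']; last first.
  have taken : `[< d = d' >] ==> (test t == char_vec X d').
    by apply/implyP => /asboolP <-; apply/eqP.
  by rewrite /= tS taken -char_vec_transition; apply: acc.
have taken d' :
    (source t \in S) && (`[< d = d' >] ==> (test t == char_vec X d')).
  apply: contraT => /negbTE dead; have := acc d'.
  by rewrite /= dead (negPf (profile_dead _ _)).
have := taken d; rewrite asboolT // => /andP[tS /eqP tz]; split=> // d'.
by have := acc d'; rewrite /= taken char_vec_transition.
Qed.

Lemma sa_run_profiles (d0 : D) w S X :
  (exists q c', [/\ q \in S, sa_run (A := A) (q, X) w c' & accepting c']) <->
  exists2 v, relabel letter v = w & profiles_accepted S X v.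
Proof.
elim: w S X => [|[a d] w IH] S X.
  split=> [[q [_ [qS <- /accepting_char_vec[qF acc]]]]|[[|//] _ acc]].
    exists [::] => // d; apply/andP; split; last exact: acc.
    by apply/exists_inP; exists q.
  have /andP[/exists_inP[q qS qF] _] := acc d0.
  exists q, (q, X); split=> //; apply/accepting_char_vec; split=> // d.
  by have /andP[] := acc d.
split.
- move=> [q [c' [qS [c1 /sa_stepP[t [<- tq tz c1E]] run_w] acc]]].
  have [|v <- acc_v] := (IH [set target t]%SET (transition_sets t d X)).1.
    by exists (target t), c'; rewrite inE -c1E.
  by exists ((t, d) :: v) => //; apply/profiles_accepted_cons; rewrite tq.
- move=> [[//|[t d'] v] [<- <- {d} vw] /profiles_accepted_cons[tS tz acc]].
  have runE := IH [set target t]%SET (transition_sets t d' X).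
  have [|q [c' [+ run_v acc']]] := runE.2; first by exists v.
  rewrite inE => /eqP qE; rewrite {q}qE in run_v.
  exists (source t), c'; split=> //.
  exists (target t, transition_sets t d' X) => //.
  by apply/sa_stepP; exists t.
Qed.

Lemma sa_class_recognizable : infinite_set [set: D] ->
  class_recognizable (sa_language A : data_language Sigma D).
Proof.
move=> infD; have [d0 _] := infinite_setN0 infD.
exists transition, letter,
  (fun s => profile_accepting (foldl profile_step (sa_init A, null_vec Y) s)).
split; first exact: regular_foldl.
have empty_vec d : char_vec (fun _ : Y => @set0 D) d = null_vec Y.
  by apply/char_vec_null => -[].
have runE w := sa_run_profiles d0 w (sa_init A) (fun=> set0).
apply/seteqP; split=> w /=.
- move=> [[q X] [c' [[/= qI X0] run_w acc]]].
  have XE : X = fun=> set0 by apply/funext.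
  have [|v <- acc_v] := (runE w).1; first by exists q, c'; rewrite -XE.
  by exists v => // d; have := acc_v d; rewrite empty_vec.
- move=> [v acc vw]; have [|q [c' [qI run_w acc']]] := (runE w).2.
    by exists v => // d; rewrite empty_vec.
  by exists (q, fun=> set0), c'.
Qed.

End SetAutomataToClassLanguages.

(** * From class languages to set automata *)

Section OneHot.
Variable Y : finType.
Implicit Types o : option Y.

Definition one_hot o : bvec Y := [ffun y => o == Some y].

Lemma one_hot_inj : injective one_hot.
Proof.
move=> [s|] [s'|] //= /ffunP e.
- by have := e s; rewrite !ffunE eqxx => /esym/eqP.
- by have := e s; rewrite !ffunE eqxx.
- by have := e s'; rewrite !ffunE eqxx.
Qed.

Lemma one_hot_None : one_hot None = null_vec Y.
Proof. by apply/ffunP => y; rewrite !ffunE. Qed.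

Definition graph (h : Y -> Y) : brel Y := [set e | h e.1 == e.2]%SET.

Lemma update_vec_one_hot (h : Y -> Y) t o m :
  update_vec (graph h) (one_hot (Some t)) [ffun y => y != t] (one_hot o) m =
  one_hot (if m then Some t else omap h o).
Proof.
apply/ffunP => y; rewrite !ffunE.
have -> :
    [exists x, ((x, y) \in graph h) && one_hot o x] = (omap h o == Some y).
  apply/existsP/eqP => [[x]|].
    by rewrite inE ffunE => /andP[/eqP/= <- /eqP->].
  by case: o => //= x [<-]; exists x; rewrite inE ffunE !eqxx.
case: m; rewrite ?andbT ?orbF //= -[Some t == _]/(t == y) negbK [y == t]eq_sym.
by case: (t == y); rewrite ?orbT ?andbF.
Qed.

End OneHot.

Section ClassLanguagesToSetAutomata.
Variables (D : Type) (Sigma B : finType) (f : B -> Sigma).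
Variables (Q : finType) (step : Q -> B * bool -> Q) (q0 : Q) (p : pred Q).
Implicit Types (q : Q) (o : D -> option Q) (X : Q -> set D) (v : seq (B * D)).

(* The control state is the state of the unmarked word, hence of every datum not
   seen yet; a seen datum lies in exactly one set, named after the state of its
   class word. *)
Definition class_trans (x : Q * B * option Q) :
    Q * Sigma * bvec Q * brel Q * bvec Q * bvec Q * Q :=
  let: (q, b, s) := x in
  let t := step (odflt q s) (b, true) in
  (q, f b, one_hot s, graph (fun r => step r (b, false)),
   one_hot (Some t), [ffun y => y != t], step q (b, false)).

Definition class_set_automaton : set_automaton Sigma :=
  SetAutomaton [set class_trans x | x : Q * B * option Q]%SET
    [set q0]%SET [set q | p q]%SET [set one_hot (Some q) | q in p]%SET.

Definition stores o X : Prop :=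
  forall d, char_vec (A := class_set_automaton) X d = one_hot (o d).

Definition next_states q b d o : D -> option Q := fun d' =>
  if `[< d = d' >] then Some (step (odflt q (o d)) (b, true))
  else omap (fun s => step s (b, false)) (o d').

Lemma odflt_next_states q b d o d' :
  odflt (step q (b, false)) (next_states q b d o d') =
  step (odflt q (o d')) (b, `[< d = d' >]).
Proof. by rewrite /next_states; case: asboolP => [->//|_]; case: (o d'). Qed.

Lemma infinite_next_states q b d o :
  infinite_set [set d' | o d' = None] ->
  infinite_set [set d' | next_states q b d o d' = None].
Proof.
move/infinite_setD => /(_ [set d] (finite_set1 d)); apply: sub_infinite_set.
move=> d' [/= od' dd']; rewrite /next_states od'.
by case: asboolP => // e; case: dd'.
Qed.

Definition class_update s q b d X : Q -> set D :=
  let: (_, rho, u, v, _) := class_trans (q, b, s) in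
  set_update (A := class_set_automaton) rho u v d X.

Lemma stores_class_update q X o b d : stores o X ->
  stores (next_states q b d o) (class_update (o d) q b d X).
Proof.
move=> oX d'; rewrite char_vec_update oX.
exact: (update_vec_one_hot (fun s => step s (b, false))).
Qed.

Lemma class_sa_stepP q X o a d c : stores o X ->
  sa_step (A := class_set_automaton) (q, X) (a, d) c <->
  exists2 b, f b = a & c = (step q (b, false), class_update (o d) q b d X).
Proof.
move=> oX; split=> [[rho [u [v [/imsetP[[[q' b] s] _ /= tE] cE]]]]|[b <- ->]].
  case: tE cE => -> aE; rewrite oX => /one_hot_inj <- -> -> -> c1E c2E.
  exists b => //.
  by rewrite -c1E -[class_update _ _ _ _ _]c2E -surjective_pairing.
exists (graph (fun r => step r (b, false))),
  (one_hot (Some (step (odflt q (o d)) (b, true)))),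
  [ffun y => y != step (odflt q (o d)) (b, true)]; split=> //=.
by apply/imsetP; exists (q, b, o d) => //=; rewrite oX.
Qed.

Lemma accepting_stores q X o :
  infinite_set [set d | o d = None] -> stores o X ->
  accepting (A := class_set_automaton) (q, X) <-> forall d, p (odflt q (o d)).
Proof.
move=> infN oX; rewrite accepting_char_vec /= inE.
have accE s : (one_hot s == null_vec Q) ||
    (one_hot s \in [set one_hot (Some q') | q' in p]%SET) = oapp p true s.
  rewrite -one_hot_None (inj_eq (@one_hot_inj Q)); case: s => [s|//] /=.
  by apply/imsetP/idP => [[q' pq' /one_hot_inj[->]]|ps] //; exists s.
split=> [[pq acc] d|acc]; first by have := acc d; rewrite oX accE; case: (o d).
have [d0 /= od0] := infinite_setN0 infN.
split; first by have := acc d0; rewrite od0.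
by move=> d; rewrite oX accE; have := acc d; case: (o d).
Qed.

Lemma sa_run_class_word w q X o :
  infinite_set [set d | o d = None] -> stores o X ->
  (exists2 c, sa_run (A := class_set_automaton) (q, X) w c & accepting c) <->
  exists2 v, relabel f v = w &
    forall d, p (foldl step (odflt q (o d)) (class_word v d)).
Proof.
elim: w q X o => [|[a d] w IH] q X o infN oX.
  split=> [[_ <- /(accepting_stores q infN oX) acc]|[[|//] _ acc]].
    by exists [::].
  by exists (q, X) => //; apply/(accepting_stores q infN oX).
have IHb b := IH (step q (b, false)) _ _ (infinite_next_states infN)
  (stores_class_update q b d oX).
split=> [[c [c1 /(class_sa_stepP _ _ _ _ oX)[b <- ->] run_w] acc]
        |[[//|[b d'] v] [<- -> vw] acc]].
  have [|v <- acc_v] := (IHb b).1; first by exists c.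
  by exists ((b, d) :: v) => // d'; have := acc_v d'; rewrite odflt_next_states.
have [|c run_w acc_c] := (IHb b).2.
  by exists v => // d0; rewrite odflt_next_states; apply: acc.
exists c => //; eexists; last exact: run_w.
by apply/(class_sa_stepP _ _ _ _ oX); exists b.
Qed.

Lemma class_set_automatonE : infinite_set [set: D] ->
  sa_language class_set_automaton =
  relabel f @` [set v | forall d, p (foldl step q0 (class_word v d))]
  :> data_language Sigma D.
Proof.
move=> infD; pose o0 (d : D) : option Q := None.
have infN : infinite_set [set d | o0 d = None].
  by apply: sub_infinite_set infD => d _.
have o0X : stores o0 (fun=> set0).
  by move=> d; rewrite one_hot_None; apply/char_vec_null => -[].
have runE w := sa_run_class_word w q0 infN o0X.
apply/seteqP; split=> w /=.
  move=> [[q X] [c [[/set1P/= -> X0] run_w acc]]].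
  have XE : X = fun=> set0 by apply/funext.
  by have [|v] := (runE w).1; [exists c; rewrite -?XE|exists v].
move=> [v acc vw]; have [|c run_w acc_c] := (runE w).2; first by exists v.
by exists (q0, fun=> set0), c; split=> //; split; rewrite //= inE.
Qed.

End ClassLanguagesToSetAutomata.

Lemma class_recognizable_sa (D : Type) (Sigma : finType)
    (L : data_language Sigma D) :
  infinite_set [set: D] -> class_recognizable L ->
  exists A : set_automaton Sigma, L = sa_language A.
Proof.
move=> infD [B [f [C [/regularP[Q [step [q0 [p CE]]]] ->]]]].
exists (class_set_automaton f step q0 p); rewrite class_set_automatonE //.
by congr (_ @` _); apply/seteqP; split=> v Cv d; apply/CE; apply: Cv.
Qed.

(** * From class languages to formulas *)

Definition other_var (x : var) : var := if x is vx then vy else vx.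

Section Definability.
Variables (D : Type) (Sigma : finType) (n : nat) (C : finType).
Variables (code : C -> ext_letter Sigma n) (code_inj : injective code).
Implicit Types (v : seq (C * D)) (R : seq (C * D) -> nat -> nat -> Prop).
Implicit Types (c : C) (phi : fo2 Sigma n) (x y t : var) (e : var -> nat).

(* Either variable may name either position, so that exchanging the arguments of
   [R] needs no renaming of variables in formulas. *)
Definition definable R : Prop := forall x y, exists phi, forall v e,
  (forall t, e t < size v) ->
  (models (relabel code v) e phi <-> R v (e x) (e y)).

Lemma eq_definable R R' :
  (forall v i j, i < size v -> j < size v -> (R v i j <-> R' v i j)) ->
  definable R -> definable R'.
Proof.
move=> RR' dR x y; have [phi phiR] := dR x y; exists phi => v e ev.
by rewrite phiR // RR'.
Qed.

Lemma definable_swap R : definable R -> definable (fun v i j => R v j i).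
Proof. by move=> dR x y; apply: dR. Qed.

Lemma definable_not R : definable R -> definable (fun v i j => ~ R v i j).
Proof.
move=> dR x y; have [phi phiR] := dR x y; exists (FNot phi) => v e ev.
by rewrite -phiR.
Qed.

Lemma definable_and R R' : definable R -> definable R' ->
  definable (fun v i j => R v i j /\ R' v i j).
Proof.
move=> dR dR' x y; have [phi phiR] := dR x y; have [phi' phiR'] := dR' x y.
by exists (FAnd phi phi') => v e ev; rewrite -phiR // -phiR'.
Qed.

Lemma definable_imply R R' : definable R -> definable R' ->
  definable (fun v i j => R v i j -> R' v i j).
Proof.
move=> dR dR'; have := definable_not (definable_and dR (definable_not dR')).
by apply: eq_definable => v i j _ _; rewrite not_andP notK implyE.
Qed.

Lemma definable_cst (P : Prop) : definable (fun _ _ _ => P).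
Proof.
move=> x y; have [holds|fails] := pselect P.
  by exists (@FEq Sigma n x x) => v e _; split.
by exists (@FLt Sigma n x x) => v e _; rewrite /models /= ltnn; split.
Qed.

Lemma definable_forall_fin (I : finType)
    (R : I -> seq (C * D) -> nat -> nat -> Prop) :
  (forall a, definable (R a)) -> definable (fun v i j => forall a, R a v i j).
Proof.
move=> dR; suff dRs (s : seq I) :
    definable (fun v i j => forall a, a \in s -> R a v i j).
  apply: eq_definable (dRs (enum I)) => v i j _ _.
  by split=> [Rs a|Rs a _]; apply: Rs; rewrite ?mem_enum.
elim: s => [|a s IH].
  by apply: eq_definable (definable_cst True) => v i j.
apply: eq_definable (definable_and (dR a) IH) => v i j _ _.
split=> [[Ra Rs] b|Rs]; first by rewrite inE => /predU1P[->|/Rs].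
by split=> [|b bs]; apply: Rs; rewrite inE ?eqxx ?bs ?orbT.
Qed.

Lemma definable_forall R : definable R ->
  definable (fun v i _ => forall k, k < size v -> R v i k).
Proof.
move=> dR x y; pose x' := other_var x; have [phi phiR] := dR x x'.
exists (FAll x' phi) => v e ev; rewrite /models /= !size_map.
have phiE k : k < size v ->
    models (relabel code v) (update e x' k) phi <-> R v (e x) k.
  have [xE x'E] : update e x' k x = e x /\ update e x' k x' = k.
    by rewrite /x'; case: (x).
  by move=> vk; rewrite phiR ?xE ?x'E // => t; rewrite /update; case: ifP.
by split=> all_k k vk; apply/phiE => //; apply: all_k.
Qed.

Lemma definable_lt : definable (fun v i j => i < j).
Proof. by move=> x y; exists (@FLt Sigma n x y). Qed.

Lemma definable_same_data : definable (fun v i j => same_data v i j).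
Proof.
move=> x y; exists (@FSim Sigma n x y) => v e _.
by rewrite /models /= !same_data_relabel.
Qed.

Lemma definable_class_succ : definable (fun v i j => class_succ v i j).
Proof.
move=> x y; exists (@FClassSucc Sigma n x y) => v e _.
by rewrite /models /= !class_succ_relabel.
Qed.

Lemma definable_between (L : set (seq C)) : regular L ->
  definable (fun v i j => i < j /\ L (between (map fst v) i j)).
Proof.
move=> rL x y; exists (FReg (regular_image code_inj rL) x y) => v e _.
rewrite /models /= ext_word_ext_sets map_fst_relabel !map_between.
split=> -[xy Lxy]; split=> //; last exact: imageP.
by case: Lxy => s Ls /(inj_map code_inj) <-.
Qed.

Lemma definable_label c : definable (fun v i _ => onth (map fst v) i = Some c).
Proof.
have dletter : definable (fun v i _ =>
    has_letter (relabel fst (relabel code v)) (code c).1 i).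
  by move=> x y; exists (@FLetter Sigma n (code c).1 x).
have dset k : definable (fun v i _ =>
    ext_sets (relabel code v) k i <-> k \in (code c).2).
  have dk : definable (fun v i _ => ext_sets (relabel code v) k i).
    by move=> x y; exists (@FSet Sigma n k x).
  exact: definable_and (definable_imply dk (definable_cst _))
    (definable_imply (definable_cst _) dk).
have := definable_and dletter (definable_forall_fin dset).
apply: eq_definable => v i _ vi _; have [[c' d] ic] := onth_ex vi.
rewrite /ext_sets /has_letter !onth_map ic /=.
split=> [[[d' [letterE _]] setE]|[->]].
  congr Some; apply: code_inj.
  rewrite [LHS]surjective_pairing [RHS]surjective_pairing.
  by congr (_, _) => //; apply/setP => k; apply/idP/idP => /setE.
by split; [exists d|].
Qed.

Lemma definable_forall_label (R : C -> seq (C * D) -> nat -> nat -> Prop) :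
  (forall c, definable (R c)) ->
  definable (fun v i j => forall c, onth (map fst v) i = Some c -> R c v i j).
Proof.
move=> dR; apply: definable_forall_fin => c.
by apply: definable_imply (dR c); apply: definable_label.
Qed.

Lemma definable_at_first R :
  definable R -> definable (fun v _ j => R v 0 j).
Proof.
move=> dR.
have dfirst : definable (fun v k _ => forall l, l < size v -> ~ l < k).
  exact: definable_forall (definable_not (definable_swap definable_lt)).
have := definable_forall (definable_swap (definable_imply dfirst dR)).
move/definable_swap; apply: eq_definable => v i j _ vj.
have v0 : 0 < size v by apply: leq_ltn_trans vj.
split=> [/(_ 0 v0)|R0 k vk no_l]; first exact.
by case: k vk no_l => // k _ /(_ 0 v0); case.
Qed.

Lemma definable_at_last R :
  definable R -> definable (fun v i _ => R v i (size v).-1).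
Proof.
move=> dR.
have dlast : definable (fun v k _ => forall l, l < size v -> ~ k < l).
  exact: definable_forall (definable_not definable_lt).
have := definable_forall (definable_imply (definable_swap dlast) dR).
apply: eq_definable => v i j vi _.
have v0 : 0 < size v by apply: leq_ltn_trans vi.
have last_lt : (size v).-1 < size v by rewrite prednK.
split=> [/(_ _ last_lt)|Rlast k vk no_l].
  by apply=> l; rewrite -{1}(prednK v0) ltnS leqNgt => /negP.
suff -> : k = (size v).-1 by [].
apply/eqP; rewrite -eqSS (prednK v0) eqn_leq vk leqNgt.
by apply/negP => /no_l; apply.
Qed.

(* A regular predicate reads only the letters strictly between two positions,
   whence a case distinction on the first letter of the prefix. *)
Lemma definable_prefix (L : set (seq C)) : regular L ->
  definable (fun v i _ => L (take i (map fst v))).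
Proof.
move=> rL; have dR : definable (fun v k i => (~ k < i -> L [::]) /\
    forall c, onth (map fst v) k = Some c -> k < i ->
      k < i /\ L (c :: between (map fst v) k i)).
  apply: definable_and; last first.
    apply: definable_forall_label => c.
    exact: definable_imply definable_lt (definable_between (regular_cons c rL)).
  by apply: definable_imply (definable_cst _); apply/definable_not/definable_lt.
apply: eq_definable (definable_swap (definable_at_first dR)) => v [|i] _ vi _.
  by rewrite take0; split=> [[/(_ notF)]|].
have [c vc] : exists c, onth (map fst v) 0 = Some c.
  by apply: onth_ex; rewrite size_map; apply: leq_ltn_trans vi.
rewrite (take_onth vc) // take0 cat0s; split=> [[_ /(_ c vc isT)[]]//|Lc].
by split=> [/(_ isT)//|c']; rewrite vc => -[<-].
Qed.

Lemma definable_suffix (L : set (seq C)) : regular L ->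
  definable (fun v i _ => L (drop i.+1 (map fst v))).
Proof.
move=> rL; have dR : definable (fun v i k => (~ i < k -> L [::]) /\
    forall c, onth (map fst v) k = Some c -> i < k ->
      i < k /\ L (rcons (between (map fst v) i k) c)).
  apply: definable_and; last first.
    apply/definable_swap/definable_forall_label => c.
    exact: definable_imply (definable_swap definable_lt)
      (definable_swap (definable_between (regular_rcons c rL))).
  by apply: definable_imply (definable_cst _); apply/definable_not/definable_lt.
apply: eq_definable (definable_at_last dR) => v i _ vi _.
rewrite -between_size size_map; case szv : (size v) vi => [//|k] vi.
have [c vc] : exists c, onth (map fst v) k = Some c.
  by apply: onth_ex; rewrite size_map szv.
move: vi; rewrite ltnS leq_eqVlt => /predU1P[->|ik].
  have -> : between (map fst v) k k.+1 = [::].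
    by rewrite /between drop_oversize // size_take_min geq_minl.
  by rewrite ltnn; split=> [[/(_ notF)]|].
rewrite (betweenS vc ik); split=> [[_ /(_ c vc ik)[]]//|Lc].
by split=> [/(_ ik)//|c']; rewrite vc => -[<-].
Qed.

Definition expressible (K : set (seq (C * D))) : Prop :=
  exists2 phi, forall t, ~~ free phi t &
    forall v, models (relabel code v) (fun=> 0) phi <-> K v.

Lemma eq_expressible (K K' : set (seq (C * D))) :
  (forall v, K v <-> K' v) -> expressible K -> expressible K'.
Proof.
by move=> KK' [phi phi_closed phiK]; exists phi => // v; rewrite -KK'.
Qed.

Lemma expressible_and (K K' : set (seq (C * D))) :
  expressible K -> expressible K' -> expressible (K `&` K').
Proof.
move=> [phi phi_closed phiK] [phi' phi'_closed phi'K'].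
exists (FAnd phi phi') => [t|v].
  by rewrite /= negb_or phi_closed phi'_closed.
by rewrite /setI /= -phiK -phi'K'.
Qed.

Lemma expressible_forall R : definable R ->
  expressible (fun v => forall i j, i < size v -> j < size v -> R v i j).
Proof.
move=> /(_ vx vy)[phi phiR]; exists (FAll vx (FAll vy phi)) => [[]//|v].
pose upd i j := update (update (fun=> 0) vx i) vy j.
have phiE i j : i < size v -> j < size v ->
    models (relabel code v) (upd i j) phi <-> R v i j.
  by move=> vi vj; apply: phiR => -[].
rewrite /models /= !size_map; split=> all_ij i.
  by move=> j vi vj; apply/phiE/all_ij.
by move=> vi j vj; apply/phiE/all_ij.
Qed.

Lemma expressible_nil (P : Prop) : expressible (fun v => v = [::] -> P).
Proof.
have [holds|fails] := pselect P.
  by exists (FAll vx (@FEq Sigma n vx vx)) => [[]|v].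
exists (FEx vx (@FEq Sigma n vx vx)) => [[]|v]; rewrite /models //= !size_map.
split=> [[i vi _] v0|nonempty]; first by rewrite v0 in vi.
by exists 0 => //; case: (v) nonempty => // /(_ erefl).
Qed.

Lemma expressible_regular (L : set (seq C)) : regular L ->
  expressible (fun v => L (map fst v)).
Proof.
move=> rL; have dR : definable (fun v _ k =>
    forall c, onth (map fst v) k = Some c -> L (rcons (take k (map fst v)) c)).
  by apply/definable_swap/definable_forall_label => c;
    exact: definable_prefix (regular_rcons c rL).
have := expressible_and (expressible_nil (L [::]))
  (expressible_forall (definable_at_last dR)).
apply: eq_expressible => v; rewrite /setI /=.
have rconsE c : onth (map fst v) (size v).-1 = Some c ->
    map fst v = rcons (take (size v).-1 (map fst v)) c.
  move=> vc; rewrite -(onth_takeS vc); have := onth_lt vc.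
  by rewrite -(size_map fst); case: (map fst v) => //= a s _; rewrite take_size.
split=> [[L_nil L_last]|Lv].
  case: v rconsE L_nil L_last => [|x v] rconsE L_nil L_last; first exact: L_nil.
  have [c vc] : exists c, onth (map fst (x :: v)) (size v) = Some c.
    by apply: onth_ex; rewrite size_map.
  by rewrite (rconsE c vc); apply: (L_last 0 0).
by split=> [v0|i j _ _ c /rconsE <-]; first by rewrite v0 in Lv.
Qed.

End Definability.

(* There is one set variable per letter [c], for the positions labelled [c]. *)
Definition singleton_code (Sigma C : finType) (f : C -> Sigma) (c : C) :
    ext_letter Sigma #|C| :=
  (f c, [set enum_rank c]%SET).

Lemma singleton_code_inj (Sigma C : finType) (f : C -> Sigma) :
  injective (singleton_code f).
Proof. by move=> c c' [_ /set1_inj/enum_rank_inj]. Qed.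

Lemma expressible_relabel_emso2 (D : Type) (Sigma C : finType) (f : C -> Sigma)
    (K : set (seq (C * D))) :
  expressible (singleton_code f) K ->
  exists phi : emso2 Sigma, emso2_language phi = relabel f @` K.
Proof.
move=> [phi phi_closed phiK]; pose code := singleton_code f.
have [psi psi_closed psiE] : expressible id
    (fun u : seq (ext_letter Sigma #|C| * D) =>
    forall i j, i < size u -> j < size u ->
    forall g, onth (map fst u) i = Some g -> exists c, code c = g).
  apply/expressible_forall/definable_forall_label => [|g]; first exact: inj_id.
  exact: definable_cst.
have closed t : ~~ free (FAnd psi phi) t.
  by rewrite /= negb_or psi_closed phi_closed.
exists (EMSO2 closed); rewrite emso2_languageE.
apply/seteqP; split=> w /=.
- move=> [u [psi_u phi_u] <-].
  have [|v vu] := @relabel_surj D C _ code u.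
    move=> i g ui; rewrite -[u]relabel_id in psi_u; move/psiE: psi_u => coded.
    have iu : i < size u by have := onth_lt ui; rewrite size_map.
    exact: (coded i i).
  by exists v; [apply/phiK; rewrite vu|rewrite -vu relabel_comp].
- move=> [v Kv <-]; exists (relabel code v); last by rewrite relabel_comp.
  split; last exact/phiK.
  rewrite -[relabel code v]relabel_id; apply/psiE => i j _ _ g.
  by rewrite map_fst_relabel onth_map; case: onth => //= c [<-]; exists c.
Qed.

Section ClassRuns.
Variables (D : Type) (B Q : finType).
Variables (step : Q -> B * bool -> Q) (q0 : Q) (p : pred Q).
Implicit Types (v : seq (B * Q * D)) (d : D) (c : B * Q) (i j : nat) (q : Q).

Definition class_state (u : seq (B * D)) d : Q :=
  foldl step q0 (class_word u d).

(* The label of a position carries the state reached just before it. *)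
Definition annotated v : Prop := forall i c d, onth v i = Some (c, d) ->
  c.2 = class_state (relabel fst (take i v)) d.

Definition unmarked_run q (s : seq (B * Q)) : Q :=
  foldl (fun r c => step r (c.1, false)) q s.

Definition state_after c : Q := step c.2 (c.1, true).

Definition first_of_class v i : Prop :=
  exists2 d, has_datum v d i & ~~ seen (take i v) d.

Definition last_of_class v i : Prop :=
  exists2 d, has_datum v d i & ~~ seen (drop i.+1 v) d.

Definition first_rule v i : Prop := forall c, onth (map fst v) i = Some c ->
  first_of_class v i -> c.2 = unmarked_run q0 (take i (map fst v)).

Definition succ_rule v i j : Prop := forall c c',
  onth (map fst v) i = Some c -> onth (map fst v) j = Some c' ->
  class_succ v i j ->
  c'.2 = unmarked_run (state_after c) (between (map fst v) i j).

Definition last_rule v i : Prop := forall c, onth (map fst v) i = Some c ->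
  last_of_class v i -> p (unmarked_run (state_after c) (drop i.+1 (map fst v))).

Lemma first_of_classP v i c d : onth v i = Some (c, d) ->
  first_of_class v i <-> ~~ seen (take i v) d.
Proof.
move=> ic; have di : has_datum v d i by exists c.
by split=> [[d' /(has_datum_inj di) ->]|unseen_d]; last by exists d.
Qed.

Lemma last_of_classP v i c d : onth v i = Some (c, d) ->
  last_of_class v i <-> ~~ seen (drop i.+1 v) d.
Proof.
move=> ic; have di : has_datum v d i by exists c.
by split=> [[d' /(has_datum_inj di) ->]|unseen_d]; last by exists d.
Qed.

Lemma annotated_ex (u : seq (B * D)) :
  exists2 v, relabel fst v = u & annotated v.
Proof.
elim/last_ind: u => [|u [b d] [v vu av]].
  by exists [::] => // i c d; rewrite onth0n.
exists (rcons v (b, class_state u d, d)).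
  by rewrite /relabel map_rcons -vu.
move=> i c d'; rewrite -cats1 onth_cat.
case: ltnP => [iv vi|vi]; first by rewrite takel_cat ?(ltnW iv) //; apply: av.
case/onth1P => /eqP; rewrite subn_eq0 => iv [<- <-].
have -> : i = size v by apply/eqP; rewrite eqn_leq iv.
by rewrite take_size_cat // vu.
Qed.

Lemma unseen_unmarked_run v d q : ~~ seen v d ->
  foldl step q (class_word (relabel fst v) d) = unmarked_run q (map fst v).
Proof.
move=> vd; rewrite class_word_relabel (unseen_class_word vd) /unmarked_run.
by elim: (map fst v) q => //= c s IH q; apply: IH.
Qed.

Lemma class_state_last_seen v i j c d : onth v i = Some (c, d) ->
  c.2 = class_state (relabel fst (take i v)) d ->
  i < j -> ~~ seen (between v i j) d ->
  class_state (relabel fst (take j v)) d =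
  unmarked_run (state_after c) (map fst (between v i j)).
Proof.
move=> vi cE ij /unseen_unmarked_run <-.
rewrite (take_onth vi ij) /class_state.
rewrite /relabel /class_word !map_cat foldl_cat /= asboolT //.
by rewrite /state_after cE.
Qed.

Lemma annotated_first_rule v i : annotated v -> first_rule v i.
Proof.
move=> av c /labelP[d ic] /(first_of_classP ic) unseen_d.
by rewrite (av _ _ _ ic) /class_state unseen_unmarked_run // map_take.
Qed.

Lemma annotated_succ_rule v i j : annotated v -> succ_rule v i j.
Proof.
move=> av c c' /labelP[d ic] /labelP[d' jc'].
have di : has_datum v d i by exists c.
case/(class_succP (or_introl di)) => ij _ dj unseen_d.
have dj' : has_datum v d' j by exists c'.
rewrite (av _ _ _ jc') (has_datum_inj dj' dj).
by rewrite (class_state_last_seen ic (av _ _ _ ic)) // map_between.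
Qed.

Lemma rules_annotated v :
  (forall i, i < size v -> first_rule v i) ->
  (forall i j, i < size v -> j < size v -> succ_rule v i j) -> annotated v.
Proof.
move=> first_v succ_v j; elim/ltn_ind: j => j IH c d jc.
have vj := onth_lt jc; have dj : has_datum v d j by exists c.
have jl : onth (map fst v) j = Some c by apply/labelP; exists d.
have [unseen_d|[i [ij [c' ic'] unseen_d]]] := unseen_or_last v d j.
  rewrite (first_v j vj c jl); last exact/(first_of_classP jc).
  by rewrite /class_state unseen_unmarked_run // map_take.
rewrite (class_state_last_seen ic' (IH _ ij _ _ ic')) // -map_between.
apply: (succ_v i j) => //; first exact: onth_lt ic'.
  by apply/labelP; exists d.
by apply/(class_succP (or_intror dj)); split=> //; exists c'.
Qed.

Lemma annotated_accepted v : infinite_set [set: D] -> annotated v ->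
  (forall i, i < size v -> last_rule v i) /\ p (unmarked_run q0 (map fst v)) <->
  forall d, p (class_state (relabel fst v) d).
Proof.
move=> infD av.
have lastE i c d : onth v i = Some (c, d) -> ~~ seen (drop i.+1 v) d ->
    class_state (relabel fst v) d =
    unmarked_run (state_after c) (drop i.+1 (map fst v)).
  move=> ic; rewrite -between_size => unseen_d; have vi := onth_lt ic.
  rewrite -{1}(take_size v) (class_state_last_seen ic (av _ _ _ ic) vi) //.
  by rewrite between_size map_drop.
split=> [[last_v unmarked_v] d|acc].
  have := unseen_or_last v d (size v); rewrite take_size.
  case=> [unseen_d|[i [vi [c ic]]]].
    by rewrite /class_state unseen_unmarked_run.
  rewrite between_size => unseen_d; rewrite (lastE i c) //.
  by apply: last_v => //; [apply/labelP; exists d|apply/(last_of_classP ic)].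
split=> [i vi c /labelP[d ic] /(last_of_classP ic) unseen_d|].
  by rewrite -(lastE i c d).
have [d unseen_d] := fresh_datum v infD.
by rewrite -(unseen_unmarked_run _ unseen_d); apply: acc.
Qed.

End ClassRuns.

Section DefinableRules.
Variables (D : Type) (Sigma B Q : finType) (n : nat).
Variables (code : B * Q -> ext_letter Sigma n) (code_inj : injective code).
Variables (step : Q -> B * bool -> Q) (q0 : Q) (p : pred Q).
Local Notation definable := (definable (D := D) code).
Local Notation unmarked_run := (unmarked_run step).

Lemma definable_first_of_class : definable (fun v i _ => first_of_class v i).
Proof.
have := definable_forall (definable_swap (definable_imply (definable_lt D code)
  (definable_not (definable_same_data D code)))).
apply: eq_definable => v i j vi _; have [d di] := has_datum_ex vi.
split=> [unseen_i|[d' di' /negP unseen_i] k vk ki].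
  exists d => //; apply/negP => /seen_take[k ki dk]; apply: (unseen_i k) => //.
    exact: has_datum_lt dk.
  by exists d.
move=> /(same_dataP (or_intror di'))[dk _]; apply: unseen_i.
by apply/seen_take; exists k.
Qed.

Lemma definable_last_of_class : definable (fun v i _ => last_of_class v i).
Proof.
have := definable_forall (definable_imply (definable_lt D code)
  (definable_not (definable_same_data D code))).
apply: eq_definable => v i j vi _; have [d di] := has_datum_ex vi.
split=> [unseen_i|[d' di' /negP unseen_i] k vk ik].
  exists d => //; apply/negP => /seen_drop[k ik dk]; apply: (unseen_i k) => //.
    exact: has_datum_lt dk.
  by exists d.
move=> /(same_dataP (or_introl di'))[_ dk]; apply: unseen_i.
by apply/seen_drop; exists k.
Qed.

Lemma regular_unmarked_run q (P : Q -> Prop) :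
  regular (fun s => P (unmarked_run q s)).
Proof.
pose unmarked_step r (c : B * Q) := step r (c.1, false).
apply: eq_regular (regular_foldl unmarked_step q (fun r => `[< P r >])) => s.
by rewrite asboolE.
Qed.

Lemma definable_first_rule : definable (fun v i _ => first_rule step q0 v i).
Proof.
apply: (definable_forall_label code_inj) => c.
apply: definable_imply definable_first_of_class _.
exact: (definable_prefix D code_inj (regular_unmarked_run q0 (eq c.2))).
Qed.

Lemma definable_last_rule : definable (fun v i _ => last_rule step p v i).
Proof.
apply: (definable_forall_label code_inj) => c.
apply: definable_imply definable_last_of_class _.
exact: (definable_suffix D code_inj
  (regular_unmarked_run (state_after step c) p)).
Qed.

Lemma definable_succ_rule : definable (fun v i j => succ_rule step v i j).
Proof.
have dlabels : definable (fun v i j => forall c, onth (map fst v) i = Some c ->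
    forall c', onth (map fst v) j = Some c' -> class_succ v i j ->
    i < j /\
    c'.2 = unmarked_run (state_after step c) (between (map fst v) i j)).
  apply: (definable_forall_label code_inj) => c; apply: definable_swap.
  apply: (definable_forall_label code_inj) => c'; apply: definable_swap.
  apply: definable_imply (definable_class_succ D code) _.
  exact: (definable_between D code_inj
    (regular_unmarked_run (state_after step c) (eq c'.2))).
apply: eq_definable dlabels => v i j _ _.
split=> [succ_ij c c' ic jc ij|succ_ij c ic c' jc ij].
  by have [] := succ_ij c ic c' jc ij.
by split; [case: ij|apply: succ_ij].
Qed.

Lemma expressible_annotated : infinite_set [set: D] ->
  expressible (D := D) code [set v | annotated step q0 v /\
    forall d, p (class_state step q0 (relabel fst v) d)].
Proof.
move=> infD; have drules := definable_and definable_first_rule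
  (definable_and definable_last_rule definable_succ_rule).
have := expressible_and (expressible_forall drules)
  (expressible_regular D code_inj (regular_unmarked_run q0 p)).
apply: eq_expressible => v; rewrite /setI /=.
split=> [[rules unmarked_v]|[av acc]]; last first.
  have [last_v unmarked_v] := (annotated_accepted p infD av).2 acc.
  split=> // i j vi vj; split; first exact: annotated_first_rule.
  by split; [apply: last_v|apply: annotated_succ_rule av].
have av : annotated step q0 v.
  apply: rules_annotated => [i vi|i j vi vj]; first exact: (rules i i vi vi).1.
  exact: (rules i j vi vj).2.2.
split=> //; apply/annotated_accepted => //; split=> // i vi.
exact: (rules i i vi vi).2.1.
Qed.

End DefinableRules.

Lemma class_recognizable_emso2 (D : Type) (Sigma : finType)
    (L : data_language Sigma D) :
  infinite_set [set: D] -> class_recognizable L ->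
  exists phi : emso2 Sigma, L = emso2_language phi.
Proof.
move=> infD [B [f [C [/regularP[Q [step [q0 [p CE]]]] ->]]]].
have code_inj := @singleton_code_inj Sigma _ (f \o fst : B * Q -> Sigma).
have [phi phiE] :=
  expressible_relabel_emso2 (expressible_annotated code_inj step q0 p infD).
exists phi; rewrite phiE; apply/seteqP; split=> w /= [].
  move=> u Cu <-; have [v vu av] := annotated_ex step q0 u.
  exists v; last by rewrite -vu relabel_comp.
  by split=> // d; rewrite vu; apply/CE/Cu.
move=> v [_ acc] <-; exists (relabel fst v); last by rewrite relabel_comp.
by move=> d; apply/CE/acc.
Qed.

Theorem theorem43 (D : Type) (infD : infinite_set [set: D]) (Sigma : finType)
    (L : data_language Sigma D) :
  (exists A : set_automaton Sigma, L = sa_language A) <->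
  (exists phi : emso2 Sigma, L = emso2_language phi).
Proof.
split=> [[A ->]|[phi ->]].
  exact: (class_recognizable_emso2 infD (sa_class_recognizable A infD)).
exact: (class_recognizable_sa infD (emso2_class_recognizable phi infD)).
Qed.
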